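(* Let $T\ge1$, $1\le\Delta\le T$, $N\ge1$. If $\Delta\gg(NT)^{\delta}$ for some fixed $\delta>0$, then for every $\varepsilon>0$ $$\mathcal{M}_\infty(\Delta,T,N)\gg\Delta N(NT)^{-\varepsilon},$$ where the implied constant in the conclusion depends only on $\varepsilon$, $\delta$ and the implied constant in the hypothesis.
   Context: For $t\in\mathbb{R}$ put $\tau_{it}(n)=\sum_{ab=n}(a/b)^{it}$ and $w_t=|\zeta(1+2it)|^2$. For complex vectors ${\bf a}=(a_n)_{N\le n\le2N}$ indexed by the integers in $[N,2N]$, let $|{\bf a}|^2=\sum_{N\le n\le2N}|a_n|^2$. Define $$\mathcal{M}_\infty(\Delta,T,N)=\max_{|{\bf a}|=1}\int_{T}^{T+\Delta}w_t^{-1}\Big|\sum_{N\le n\le2N}a_n\tau_{it}(n^2)\Big|^2dt.$$ The notation $A\gg B$ (with $B\ge0$) means $A\ge cB$ for some constant $c>0$ (the implied constant). *)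

(* Defs.v *)
From Stdlib Require Export Reals ZArith Zfloor.
From Coquelicot Require Export Coquelicot.
Open Scope R_scope.

(* x^s = exp (s ln x), used for real x > 0 only. *)
Definition Rcpow (x : R) (s : C) : C :=
  (Rpower x (Re s) * cos (Im s * ln x), Rpower x (Re s) * sin (Im s * ln x)).

(* Coquelicot's [Lim_seq] is real-valued, so the limit is taken componentwise. *)
Definition CLim_seq (u : nat -> C) : C :=
  (real (Lim_seq (fun n => Re (u n))), real (Lim_seq (fun n => Im (u n)))).

(* The Riemann zeta function on the half-plane Re s > 0, s <> 1, through
     zeta(s) = lim_(M -> oo) (sum_(1 <= n <= M) n^(-s) - M^(1-s) / (1-s)).
   For Re s > 1 the subtracted term tends to 0 and this is the Dirichlet series;
   for Re s > 0 it is the analytic continuation, since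
     sum_(n <= M) n^(-s) - M^(1-s) / (1-s) = s/(s-1) - s int_1^M {x} x^(-s-1) dx,
   which converges locally uniformly there.
   The values for Re s <= 0 and s = 1 are meaningless. *)
Definition zeta (s : C) : C :=
  CLim_seq (fun M =>
    Cminus (sum_n_m (fun n => Rcpow (INR n) (Copp s)) 1 M)
           (Cdiv (Rcpow (INR M) (Cminus (RtoC 1) s)) (Cminus (RtoC 1) s))).

Definition w (t : R) : R := (Cmod (zeta (1, 2 * t))) ^ 2.

(* For n >= 1, the positive a and b with a * b = n lie in {1, ..., n}. *)
Definition tau (t : R) (n : nat) : C :=
  sum_n_m (fun a : nat =>
    sum_n_m (fun b : nat =>
      if Nat.eqb (a * b) n then Rcpow (INR a / INR b) (0, t) else RtoC 0) 1 n) 1 n.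

(* The sum over the integers n with N <= n <= 2N, for real N >= 0. *)
Definition sum_dyadic {G : AbelianMonoid} (N : R) (f : nat -> G) : G :=
  sum_n_m f (Z.to_nat (Zceil N)) (Z.to_nat (Zfloor (2 * N))).

(* A vector (a_n), N <= n <= 2N, is represented by any function nat -> C
   extending it; the quantities below only involve the values on [N, 2N]. *)
Definition norm2_dyadic (N : R) (a : nat -> C) : R :=
  sum_dyadic N (fun n => (Cmod (a n)) ^ 2).

Definition M_form (Delta T N : R) (a : nat -> C) : R :=
  RInt (fun t =>
    / w t * (Cmod (sum_dyadic N (fun n => Cmult (a n) (tau t (n ^ 2))))) ^ 2)
    T (T + Delta).

(* The maximum over the unit sphere, as a least upper bound in [Rbar]: a
   quadratic form on a finite-dimensional space is bounded on the (compact)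
   unit sphere and attains its supremum there. *)
Definition M_infty (Delta T N : R) : Rbar :=
  Lub_Rbar (fun x : R =>
    exists a : nat -> C, norm2_dyadic N a = 1 /\ x = M_form Delta T N a).

(* Main.v *)
Require Import Defs.
From Stdlib Require Import Reals Lra Lia Psatz.
From Coquelicot Require Import Coquelicot.
Open Scope R_scope.

(** The lower bound needs one good vector a, and the constant vector on [N, 2N]
    already serves.  Among the terms (a/b)^(it) of tau_(it)(n^2), the diagonal
    one a = b = n does not oscillate, so tau_(it)(n^2) has mean value 1 in t.
    If K is the number of n and a_n = 1/sqrt K, then
      |S(t)|^2 >= 2 sum_n Re tau_(it)(n^2) - K,
    and integrating over [T, T + Delta] leaves K Delta minus an off-diagonal
    error.  A pair a <> b with a b = n^2 contributes at most 2/|log(a/b)|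
    ([tau_square_mean]).  Such pairs are a = n r/s, b = n s/r with r, s coprime
    and r s | n ([square_factorisation]), so summing over n first gives
      sum_(r <> s <= 2N) (2N/(r s)) max(r,s)/|r - s| << N (1 + log 2N)^2
    ([offdiag_sum_le]).  Hence the error is negligible as soon as Delta exceeds
    a constant times (1 + log 2N)^2 ([M_infty_long_interval]).

    If Delta is smaller than that, the hypothesis Delta >= c (NT)^delta bounds
    NT, and a lower bound of order Delta suffices.  It comes from a vector
    supported on a single power n = 2^k: there tau_(it)(n^2) is the Dirichlet
    kernel sin((2k+1) theta)/sin theta with theta = t log 2, which is at least
    |sin((2k+1) theta)| in absolute value, and the square of this sine has mean
    1/2 ([M_infty_any_interval]).

    Two facts on the weight 1/w_t are needed.  It is >> T^(-eps), because
    zeta(1+iy) << log y ([w_upper_bound]).  It is continuous, so that the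
    integral exists at all, because zeta is continuous and does not vanish on
    the line Re s = 1 ([zeta_nonzero]).  Everything about zeta follows from one
    estimate: for Re s >= 1 the truncation
      sum_(n <= M) n^(-s) - M^(1-s)/(1-s)
    is within 4 (|Re s| + |Im s|)/M of zeta(s) ([zeta_approx]).  For the
    nonvanishing, the 3-4-1 inequality
      zeta(sigma)^3 |zeta(sigma+iy)|^4 |zeta(sigma+2iy)| >= 1
    ([three_four_one]) at sigma = 1 + 1/M contradicts the bound
    |zeta(sigma+iy)| << (1 + log M)^2/M which the truncation at M yields when
    zeta(1+iy) = 0. *)

(** Rewriting under big sums leaves equations typed in the carrier of a canonical
    structure, which [ring] does not recognise as R or C. *)
Ltac ring_in_R := match goal with |- ?a = ?b => change (@eq R a b) end; ring.
Ltac ring_in_C := match goal with |- ?a = ?b => change (@eq C a b) end; ring.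

(** * Truncated sums approximate zeta up to the line Re s = 1 *)

Lemma Re_sum (f : nat -> C) (n m : nat) :
  Re (sum_n_m f n m) = sum_n_m (fun k => Re (f k)) n m.
Proof.
  destruct (Nat.lt_ge_cases m n) as [H|H].
  - rewrite !sum_n_m_zero by easy. reflexivity.
  - induction H as [|m H IH]; [now rewrite !sum_n_n|].
    rewrite !sum_n_Sm by lia. rewrite <- IH. reflexivity.
Qed.

Lemma Im_sum (f : nat -> C) (n m : nat) :
  Im (sum_n_m f n m) = sum_n_m (fun k => Im (f k)) n m.
Proof.
  destruct (Nat.lt_ge_cases m n) as [H|H].
  - rewrite !sum_n_m_zero by easy. reflexivity.
  - induction H as [|m H IH]; [now rewrite !sum_n_n|].
    rewrite !sum_n_Sm by lia. rewrite <- IH. reflexivity.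
Qed.

(** Since K/(n(n+1)) = K/n - K/(n+1), the increments from n on add up to at most
    K/n, which gives both the convergence and the rate. *)
Lemma lim_of_telescoping_increments (u : nat -> R) (K : R) :
  (forall n, (1 <= n)%nat -> Rabs (u (S n) - u n) <= K / (INR n * INR (S n))) ->
  is_lim_seq u (real (Lim_seq u)) /\
  forall n, (1 <= n)%nat -> Rabs (real (Lim_seq u) - u n) <= K / INR n.
Proof.
  intros Hu.
  assert (HK : 0 <= K).
  { generalize (Rabs_pos (u 2%nat - u 1%nat)) (Hu 1%nat (le_n _)). simpl. lra. }
  assert (tele : forall n, (1 <= n)%nat ->
    K / (INR n * INR (S n)) = K / INR n - K / INR (S n)).
  { intros n Hn. assert (0 < INR n) by (apply lt_0_INR; lia).
    rewrite S_INR. field. lra. }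
  assert (main : forall n k, (1 <= n)%nat ->
    Rabs (u (n + k)%nat - u n) <= K / INR n - K / INR (n + k)).
  { intros n k Hn. induction k as [|k IH].
    - rewrite Nat.add_0_r, !Rminus_diag, Rabs_R0. lra.
    - rewrite Nat.add_succ_r.
      specialize (Hu (n + k)%nat ltac:(lia)). rewrite tele in Hu by lia.
      replace (u (S (n + k)) - u n)
        with ((u (S (n + k)) - u (n + k)%nat) + (u (n + k)%nat - u n)) by ring.
      eapply Rle_trans; [apply Rabs_triang|lra]. }
  assert (lim0 : is_lim_seq (fun n => K / INR n) 0).
  { apply is_lim_seq_ext with (fun n => K * / INR n); [reflexivity|].
    replace (Finite 0) with (Rbar_mult K (Rbar_inv p_infty)) by (simpl; f_equal; ring).
    apply is_lim_seq_scal_l. apply is_lim_seq_inv; [apply is_lim_seq_INR|easy]. }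
  assert (cv : ex_finite_lim_seq u).
  { apply ex_lim_seq_cauchy_corr. intros eps.
    apply is_lim_seq_spec in lim0.
    destruct (lim0 (pos_div_2 eps)) as [n0 Hn0]. simpl in Hn0.
    exists (S n0). intros n m Hn Hm.
    assert (near : forall j, (S n0 <= j)%nat -> Rabs (u j - u (S n0)) < eps / 2).
    { intros j Hj. replace j with (S n0 + (j - S n0))%nat by lia.
      eapply Rle_lt_trans; [apply main; lia|].
      assert (0 <= K / INR (S n0 + (j - S n0))).
      { apply Rdiv_le_0_compat; [easy|apply lt_0_INR; lia]. }
      specialize (Hn0 (S n0) ltac:(lia)). rewrite Rminus_0_r in Hn0.
      apply Rabs_def2 in Hn0. lra. }
    generalize (near n Hn) (near m Hm). intros A B.
    apply Rabs_def2 in A. apply Rabs_def2 in B. apply Rabs_def1; lra. }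
  apply Lim_seq_correct' in cv. split; [exact cv|].
  intros n Hn.
  assert (L : is_lim_seq (fun k => Rabs (u (k + n)%nat - u n))
                (Rabs (real (Lim_seq u) - u n))).
  { apply (is_lim_seq_abs _ (Finite (real (Lim_seq u) - u n))).
    apply is_lim_seq_minus'; [|apply is_lim_seq_const].
    apply (is_lim_seq_incr_n u n). exact cv. }
  apply (is_lim_seq_le (fun k => Rabs (u (k + n)%nat - u n)) (fun _ => K / INR n)
           (Rabs (real (Lim_seq u) - u n)) (K / INR n)); auto using is_lim_seq_const.
  intros k. rewrite Nat.add_comm.
  eapply Rle_trans; [apply main; lia|].
  assert (0 <= K / INR (n + k)); [|lra].
  apply Rdiv_le_0_compat; [easy|apply lt_0_INR; lia].
Qed.

(** Two applications of the mean value theorem: F(n+1) - F(n) = f(x) for some x,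
    and f(n+1) - f(x) is at most sup |f'|. *)
Lemma last_term_vs_increment (F f f' : R -> R) (n B : R) :
  (forall x, n <= x <= n + 1 -> is_derive F x (f x)) ->
  (forall x, n <= x <= n + 1 -> is_derive f x (f' x)) ->
  (forall x, n <= x <= n + 1 -> Rabs (f' x) <= B) ->
  Rabs (f (n + 1) - (F (n + 1) - F n)) <= B.
Proof.
  intros HF Hf HB.
  assert (HB0 : 0 <= B).
  { eapply Rle_trans; [apply Rabs_pos|apply (HB n); lra]. }
  destruct (MVT_gen F n (n + 1) f) as [x [Hx Ex]].
  - intros x. rewrite Rmin_left, Rmax_right by lra. intros; apply HF; lra.
  - intros x. rewrite Rmin_left, Rmax_right by lra. intros.
    apply continuity_pt_filterlim. apply (ex_derive_continuous F). eexists; apply HF; lra.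
  - rewrite Rmin_left, Rmax_right in Hx by lra.
    destruct (MVT_gen f x (n + 1) f') as [z [Hz Ez]].
    + intros z. rewrite Rmin_left, Rmax_right by lra. intros; apply Hf; lra.
    + intros z. rewrite Rmin_left, Rmax_right by lra. intros.
      apply continuity_pt_filterlim. apply (ex_derive_continuous f). eexists; apply Hf; lra.
    + rewrite Rmin_left, Rmax_right in Hz by lra.
      replace (f (n + 1) - (F (n + 1) - F n)) with (f' z * (n + 1 - x)) by lra.
      rewrite Rabs_mult, (Rabs_right (n + 1 - x)) by lra.
      specialize (HB z ltac:(lra)). generalize (Rabs_pos (f' z)). nra.
Qed.

(** Real and imaginary parts of multiples of x^(p + iq); differentiation only
    acts on the parameters, so one lemma serves both components of x^(-s), of
    its primitive and of its derivative. *)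
Definition oscillation (p q A B x : R) : R :=
  Rpower x p * (A * cos (q * ln x) + B * sin (q * ln x)).

Lemma is_derive_oscillation (p q A B x : R) : 0 < x ->
  is_derive (oscillation p q A B) x
    (oscillation (p - 1) q (p * A + q * B) (p * B - q * A) x).
Proof.
  intros Hx. unfold oscillation, Rpower. auto_derive; [easy|].
  replace ((p - 1) * ln x) with (p * ln x + - ln x) by ring.
  rewrite exp_plus, exp_Ropp, exp_ln by easy. field. lra.
Qed.

Lemma oscillation_bound (p q A B x : R) :
  Rabs (oscillation p q A B x) <= Rpower x p * (Rabs A + Rabs B).
Proof.
  unfold oscillation. rewrite Rabs_mult.
  assert (0 < Rpower x p) by apply exp_pos.
  rewrite (Rabs_right (Rpower x p)) by lra.
  apply Rmult_le_compat_l; [lra|].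
  eapply Rle_trans; [apply Rabs_triang|]. rewrite !Rabs_mult.
  generalize (Rabs_pos A) (Rabs_pos B) (COS_bound (q * ln x)) (SIN_bound (q * ln x)).
  intros. assert (Rabs (cos (q * ln x)) <= 1) by (apply Rabs_le; lra).
  assert (Rabs (sin (q * ln x)) <= 1) by (apply Rabs_le; lra).
  nra.
Qed.

Definition zeta_partial (s : C) (M : nat) : C :=
  Cminus (sum_n_m (fun n => Rcpow (INR n) (Copp s)) 1 M)
         (Cdiv (Rcpow (INR M) (Cminus (RtoC 1) s)) (Cminus (RtoC 1) s)).

(** F is the primitive x^(1-s)/(1-s) of x^(-s), read on the component selected
    by (A, B); the bound is |s| sup x^(-sigma-1) <= (sigma + |q|)/n^2. *)
Lemma oscillation_increment (sigma q A B : R) (n : nat) :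
  1 <= sigma -> (1 <= n)%nat -> (sigma <> 1 \/ q <> 0) -> Rabs A + Rabs B = 1 ->
  let D := (1 - sigma) ^ 2 + q ^ 2 in
  let F := oscillation (1 - sigma) q (((1 - sigma) * A - q * B) / D)
                                     (((1 - sigma) * B + q * A) / D) in
  Rabs (oscillation (- sigma) q A B (INR (S n)) - (F (INR (S n)) - F (INR n)))
    <= 2 * (sigma + Rabs q) / (INR n * INR (S n)).
Proof.
  intros Hs Hn Hsq HAB D F.
  assert (HD : 0 < D).
  { unfold D. destruct Hsq as [H|H].
    - assert (0 < (1 - sigma) ^ 2) by (apply pow2_gt_0; lra). nra.
    - assert (0 < q ^ 2) by (apply pow2_gt_0; lra). nra. }
  assert (Hn1 : 1 <= INR n) by (apply (le_INR 1); lia).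
  rewrite S_INR.
  apply (last_term_vs_increment F (oscillation (- sigma) q A B)
    (oscillation (- sigma - 1) q (- sigma * A + q * B) (- sigma * B - q * A))).
  - intros x Hx. unfold F.
    eassert (E : oscillation (- sigma) q A B x = _);
      [|rewrite E; apply is_derive_oscillation; lra].
    unfold oscillation. f_equal; [f_equal; ring|].
    unfold D in *. f_equal; f_equal; field; lra.
  - intros x Hx. apply is_derive_oscillation; lra.
  - intros x Hx. eapply Rle_trans; [apply oscillation_bound|].
    assert (P : Rpower x (- sigma - 1) <= / (INR n * INR n)).
    { apply Rle_trans with (Rpower x (- (2))).
      - apply Rle_Rpower; lra.
      - rewrite Rpower_Ropp. apply Rinv_le_contravar; [nra|].
        replace 2 with (INR 2) by (simpl; ring). rewrite Rpower_pow by lra. nra. }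
    assert (E : Rabs (- sigma * A + q * B) + Rabs (- sigma * B - q * A) <= sigma + Rabs q).
    { eapply Rle_trans; [apply Rplus_le_compat; apply Rabs_triang|].
      rewrite !Rabs_Ropp, !Rabs_mult, Rabs_Ropp, (Rabs_right sigma) by lra.
      nra. }
    apply Rle_trans with (/ (INR n * INR n) * (sigma + Rabs q)).
    + assert (0 < Rpower x (- sigma - 1)) by apply exp_pos.
      apply Rmult_le_compat; try lra.
      generalize (Rabs_pos (- sigma * A + q * B)) (Rabs_pos (- sigma * B - q * A)). lra.
    + replace (2 * (sigma + Rabs q) / (INR n * (INR n + 1)))
        with ((2 * / (INR n * (INR n + 1))) * (sigma + Rabs q)) by (field; nra).
      apply Rmult_le_compat_r; [generalize (Rabs_pos q); lra|].
      apply Rmult_le_reg_r with (INR n * INR n * (INR n + 1)); [nra|].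
      field_simplify; nra.
Qed.

(** The common argument for Re and Im: the increments of the truncations are the
    errors n^(-s) - int_(n-1)^n x^(-s) dx of [oscillation_increment]. *)
Lemma zeta_component_limit (s : C) (X : C -> R) (A B : R) :
  1 <= Re s -> s <> RtoC 1 -> Rabs A + Rabs B = 1 ->
  (forall x, X (Rcpow x (Copp s)) = oscillation (- Re s) (- Im s) A B x) ->
  (forall x, X (Cdiv (Rcpow x (Cminus (RtoC 1) s)) (Cminus (RtoC 1) s)) =
    oscillation (1 - Re s) (- Im s)
      (((1 - Re s) * A + Im s * B) / ((1 - Re s) ^ 2 + Im s ^ 2))
      (((1 - Re s) * B - Im s * A) / ((1 - Re s) ^ 2 + Im s ^ 2)) x) ->
  (forall M, X (zeta_partial s M) =
     sum_n_m (fun n => X (Rcpow (INR n) (Copp s))) 1 M -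
     X (Cdiv (Rcpow (INR M) (Cminus (RtoC 1) s)) (Cminus (RtoC 1) s))) ->
  let u M := X (zeta_partial s M) in
  is_lim_seq u (real (Lim_seq u)) /\
  forall M, (1 <= M)%nat ->
    Rabs (real (Lim_seq u) - u M) <= 2 * (Re s + Rabs (Im s)) / INR M.
Proof.
  intros Hs H1 HAB Hf HF HX u.
  apply lim_of_telescoping_increments. intros n Hn. unfold u.
  rewrite !HX, sum_n_Sm by lia. rewrite !Hf, !HF.
  assert (H : Re s <> 1 \/ - Im s <> 0).
  { destruct (Req_dec (Re s) 1) as [E|E]; [right|now left].
    intros E'. apply H1. destruct s as [a b]; simpl in *.
    unfold RtoC. f_equal; lra. }
  generalize (oscillation_increment (Re s) (- Im s) A B n Hs Hn H HAB).
  cbv zeta. rewrite Rabs_Ropp.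
  replace ((- Im s) ^ 2) with (Im s ^ 2) by ring.
  replace (- - Im s * B) with (Im s * B) by ring.
  replace ((1 - Re s) * A - - Im s * B) with ((1 - Re s) * A + Im s * B) by ring.
  replace ((1 - Re s) * B + - Im s * A) with ((1 - Re s) * B - Im s * A) by ring.
  intros G. match goal with |- Rabs ?a <= _ => match type of G with Rabs ?b <= _ =>
    replace a with b end end; [exact G|].
  change plus with Rplus. ring.
Qed.

Lemma is_lim_Re_zeta (s : C) : 1 <= Re s -> s <> RtoC 1 ->
  is_lim_seq (fun M => Re (zeta_partial s M)) (Re (zeta s)) /\
  forall M, (1 <= M)%nat ->
    Rabs (Re (zeta s) - Re (zeta_partial s M)) <= 2 * (Re s + Rabs (Im s)) / INR M.
Proof.
  intros Hs H1. apply (zeta_component_limit s Re 1 0); auto.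
  - rewrite Rabs_R1, Rabs_R0. ring.
  - intros x. destruct s as [a b]. unfold oscillation, Rcpow. simpl. ring.
  - intros x. destruct s as [a b]. unfold oscillation, Rcpow, Cdiv, Cinv, Rdiv. simpl.
    replace (1 + - a) with (1 - a) by ring.
    replace (0 + - b) with (- b) by ring. unfold Rdiv.
    replace (- b * (- b * 1)) with (b * (b * 1)) by ring. ring.
  - intros M. unfold zeta_partial, Cminus.
    rewrite <- Re_sum. reflexivity.
Qed.

Lemma is_lim_Im_zeta (s : C) : 1 <= Re s -> s <> RtoC 1 ->
  is_lim_seq (fun M => Im (zeta_partial s M)) (Im (zeta s)) /\
  forall M, (1 <= M)%nat ->
    Rabs (Im (zeta s) - Im (zeta_partial s M)) <= 2 * (Re s + Rabs (Im s)) / INR M.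
Proof.
  intros Hs H1. apply (zeta_component_limit s Im 0 1); auto.
  - rewrite Rabs_R1, Rabs_R0. ring.
  - intros x. destruct s as [a b]. unfold oscillation, Rcpow. simpl. ring.
  - intros x. destruct s as [a b]. unfold oscillation, Rcpow, Cdiv, Cinv, Rdiv. simpl.
    replace (1 + - a) with (1 - a) by ring.
    replace (0 + - b) with (- b) by ring. unfold Rdiv.
    replace (- b * (- b * 1)) with (b * (b * 1)) by ring. ring.
  - intros M. unfold zeta_partial, Cminus.
    rewrite <- Im_sum. reflexivity.
Qed.

Lemma Cmod_le_Re_Im (z : C) : Cmod z <= Rabs (Re z) + Rabs (Im z).
Proof.
  rewrite <- (sqrt_Rsqr (Rabs (Re z) + Rabs (Im z))).
  - unfold Cmod. apply sqrt_le_1_alt. unfold Rsqr.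
    rewrite <- (pow2_abs (fst z)), <- (pow2_abs (snd z)).
    generalize (Rabs_pos (fst z)) (Rabs_pos (snd z)). unfold Re, Im. nra.
  - generalize (Rabs_pos (Re z)) (Rabs_pos (Im z)). lra.
Qed.

(** The quantitative form of the definition of zeta up to the line Re s = 1, with
    an explicit dependence on s: the source of the size, the continuity and the
    nonvanishing of zeta on that line. *)
Lemma zeta_approx (s : C) (M : nat) : 1 <= Re s -> s <> RtoC 1 -> (1 <= M)%nat ->
  Cmod (Cminus (zeta s) (zeta_partial s M)) <= 4 * (Re s + Rabs (Im s)) / INR M.
Proof.
  intros Hs H1 HM. eapply Rle_trans; [apply Cmod_le_Re_Im|].
  destruct (is_lim_Re_zeta s Hs H1) as [_ A]. specialize (A M HM).
  destruct (is_lim_Im_zeta s Hs H1) as [_ B]. specialize (B M HM).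
  replace (4 * (Re s + Rabs (Im s)) / INR M) with
    (2 * (Re s + Rabs (Im s)) / INR M + 2 * (Re s + Rabs (Im s)) / INR M) by lra.
  apply Rplus_le_compat; [exact A|exact B].
Qed.

(** * Size and continuity of w *)

Lemma Cmod_sum_le (f : nat -> C) (n m : nat) :
  Cmod (sum_n_m f n m) <= sum_n_m (fun k => Cmod (f k)) n m.
Proof.
  destruct (Nat.lt_ge_cases m n) as [H|H].
  - rewrite !sum_n_m_zero by easy. change (Cmod (RtoC 0) <= 0).
    rewrite Cmod_0. apply Rle_refl.
  - induction H as [|m H IH]; [rewrite !sum_n_n; apply Rle_refl|].
    rewrite !sum_n_Sm by lia.
    eapply Rle_trans; [apply Cmod_triangle|apply Rplus_le_compat_r, IH].
Qed.

Lemma sum_le_loc (f g : nat -> R) (n m : nat) :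
  (forall k, (n <= k <= m)%nat -> f k <= g k) -> sum_n_m f n m <= sum_n_m g n m.
Proof.
  intros H. destruct (Nat.lt_ge_cases m n) as [L|L].
  - rewrite !sum_n_m_zero by easy. apply Rle_refl.
  - induction L as [|m L IH]; [rewrite !sum_n_n; apply H; lia|].
    rewrite !sum_n_Sm by lia. apply Rplus_le_compat; [|apply H; lia].
    apply IH. intros; apply H; lia.
Qed.

Lemma Cmod_Rcpow (x : R) (s : C) : Cmod (Rcpow x s) = Rpower x (Re s).
Proof.
  unfold Cmod, Rcpow; simpl.
  match goal with |- sqrt ?a = _ => replace a with (Rsqr (Rpower x (Re s))) end.
  - apply sqrt_Rsqr. left; apply exp_pos.
  - generalize (sin2_cos2 (Im s * ln x)). unfold Rsqr. intros H.
    transitivity (Rpower x (Re s) * Rpower x (Re s) *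
     (sin (Im s * ln x) * sin (Im s * ln x) + cos (Im s * ln x) * cos (Im s * ln x)));
    [rewrite H|]; ring.
Qed.

Lemma Rcpow_plus (x : R) (s s' : C) :
  Rcpow x (Cplus s s') = Cmult (Rcpow x s) (Rcpow x s').
Proof.
  destruct s as [a b], s' as [a' b']. unfold Rcpow, Cmult; simpl.
  rewrite Rpower_plus, Rmult_plus_distr_r, cos_plus, sin_plus. f_equal; ring.
Qed.

Lemma Rcpow_mult (x y : R) (s : C) : 0 < x -> 0 < y ->
  Rcpow (x * y) s = Cmult (Rcpow x s) (Rcpow y s).
Proof.
  intros Hx Hy. destruct s as [a b]. unfold Rcpow, Cmult; simpl.
  rewrite ln_mult, Rmult_plus_distr_l, cos_plus, sin_plus by easy.
  rewrite <- Rpower_mult_distr by easy. f_equal; ring.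
Qed.

Lemma Rcpow_1 (s : C) : Rcpow 1 s = RtoC 1.
Proof.
  unfold Rcpow, Rpower. rewrite ln_1, !Rmult_0_r, exp_0, cos_0, sin_0.
  unfold RtoC. f_equal; ring.
Qed.

Lemma ln_le_minus_1 (x : R) : 0 < x -> ln x <= x - 1.
Proof.
  intros Hx. generalize (exp_ineq1_le (ln x)). rewrite exp_ln by easy. lra.
Qed.

Lemma ln_ge_0 (x : R) : 1 <= x -> 0 <= ln x.
Proof. intros H. rewrite <- ln_1. apply ln_le; lra. Qed.

(** ln(M/(M+1)) <= M/(M+1) - 1 gives 1/(M+1) <= ln(M+1) - ln M. *)
Lemma harmonic_le (M : nat) : (1 <= M)%nat ->
  sum_n_m (fun n => / INR n) 1 M <= 1 + ln (INR M).
Proof.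
  intros H. induction H as [|M H IH].
  - rewrite sum_n_n. simpl. rewrite ln_1, Rinv_1. lra.
  - rewrite sum_n_Sm by lia. change plus with Rplus.
    assert (P : 0 < INR M) by (apply lt_0_INR; lia).
    assert (Q : 0 < INR (S M)) by (apply lt_0_INR; lia).
    assert (E : ln (INR M / INR (S M)) <= INR M / INR (S M) - 1).
    { apply ln_le_minus_1. apply Rdiv_lt_0_compat; easy. }
    rewrite ln_div in E by easy.
    replace (INR M / INR (S M) - 1) with (- / INR (S M)) in E
      by (rewrite S_INR in *; field; lra).
    lra.
Qed.

Lemma zeta_partial_bound (y : R) (M : nat) : y <> 0 -> (1 <= M)%nat ->
  Cmod (zeta_partial (1, y) M) <= 1 + ln (INR M) + / Rabs y.
Proof.
  intros Hy HM. unfold zeta_partial. unfold Cminus at 1.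
  eapply Rle_trans; [apply Cmod_triangle|]. rewrite Cmod_opp.
  assert (P : 0 < INR M) by (apply lt_0_INR; lia).
  apply Rplus_le_compat.
  - eapply Rle_trans; [apply Cmod_sum_le|].
    eapply Rle_trans; [|apply harmonic_le; easy].
    apply sum_le_loc. intros k Hk. rewrite Cmod_Rcpow. simpl.
    rewrite Rpower_Ropp, Rpower_1; [lra|apply lt_0_INR; lia].
  - assert (N : Cminus (RtoC 1) (1, y) = (0, - y)).
    { unfold Cminus, Cplus, Copp, RtoC. simpl. f_equal; ring. }
    rewrite N. rewrite Cmod_div.
    + rewrite Cmod_Rcpow. simpl. rewrite Rpower_O by easy.
      replace (Cmod (0, - y)) with (Rabs y); [lra|].
      unfold Cmod; simpl. rewrite <- sqrt_Rsqr_abs. f_equal. unfold Rsqr. ring.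
    + intros E. injection E. lra.
Qed.

(** Truncate at M close to t: the tail is then bounded, and the truncated sum is
    at most a harmonic sum. *)
Lemma w_upper_bound (t : R) : 1 <= t -> w t <= (14 + ln (1 + t)) ^ 2.
Proof.
  intros Ht. unfold w. apply pow_incr. split; [apply Cmod_ge_0|].
  set (M := Z.to_nat (up t)). destruct (archimed t) as [U1 U2].
  assert (EM : INR M = IZR (up t)).
  { unfold M. rewrite INR_IZR_INZ, Z2Nat.id; [easy|].
    apply le_IZR. simpl. lra. }
  assert (HM : (1 <= M)%nat) by (apply INR_le; simpl; lra).
  assert (Hs : (1, 2 * t) <> RtoC 1) by (intros E; injection E; lra).
  generalize (zeta_approx (1, 2 * t) M (Rle_refl 1) Hs HM).
  generalize (zeta_partial_bound (2 * t) M ltac:(lra) HM).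
  simpl Re. simpl Im. rewrite (Rabs_right (2 * t)) by lra. intros A B.
  replace (zeta (1, 2 * t)) with
    (Cplus (Cminus (zeta (1, 2 * t)) (zeta_partial (1, 2 * t) M))
           (zeta_partial (1, 2 * t) M)) by ring.
  eapply Rle_trans; [apply Cmod_triangle|].
  assert (E1 : ln (INR M) <= ln (1 + t)) by (apply ln_le; lra).
  assert (E2 : / (2 * t) <= / 2) by (apply Rinv_le_contravar; lra).
  assert (E3 : 4 * (1 + 2 * t) / INR M <= 12).
  { apply Rle_div_l; lra. }
  lra.
Qed.

Lemma continuous_sum (f : nat -> R -> R) (n m : nat) (x : R) :
  (forall k, (n <= k <= m)%nat -> continuous (f k) x) ->
  continuous (fun y => sum_n_m (fun k => f k y) n m) x.
Proof.
  intros H. destruct (Nat.lt_ge_cases m n) as [L|L].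
  - apply (continuous_ext (fun _ => 0)); [|apply continuous_const].
    intros y. rewrite sum_n_m_zero by easy. reflexivity.
  - induction L as [|m L IH].
    + apply (continuous_ext (f n)); [|apply H; lia].
      intros y. now rewrite sum_n_n.
    + apply (continuous_ext (fun y => plus (sum_n_m (fun k => f k y) n m) (f (S m) y))).
      * intros y. rewrite sum_n_Sm by lia. reflexivity.
      * apply (continuous_plus (fun y => sum_n_m (fun k => f k y) n m)); [|apply H; lia].
        apply IH. intros; apply H; lia.
Qed.

Lemma continuous_of_derive (f : R -> R) (x : R) : ex_derive f x -> continuous f x.
Proof. apply (ex_derive_continuous f). Qed.

Lemma continuous_Re_zeta_partial (M : nat) (t : R) : 0 < t ->
  continuous (fun t => Re (zeta_partial (1, 2 * t) M)) t.
Proof.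
  intros Ht. unfold zeta_partial.
  apply (continuous_ext (fun t =>
     minus (sum_n_m (fun n => Re (Rcpow (INR n) (Copp (1, 2 * t)))) 1 M)
     (Re (Cdiv (Rcpow (INR M) (Cminus (RtoC 1) (1, 2 * t)))
            (Cminus (RtoC 1) (1, 2 * t)))))).
  - intros x. rewrite <- Re_sum. reflexivity.
  - apply (continuous_minus (fun t =>
      sum_n_m (fun n => Re (Rcpow (INR n) (Copp (1, 2 * t)))) 1 M)).
    + apply continuous_sum. intros k _. apply continuous_of_derive.
      unfold Rcpow, Rpower; simpl. auto_derive. easy.
    + apply continuous_of_derive. unfold Rcpow, Rpower, Cdiv, Cinv; simpl.
      auto_derive. repeat split; nra.
Qed.

Lemma continuous_Im_zeta_partial (M : nat) (t : R) : 0 < t ->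
  continuous (fun t => Im (zeta_partial (1, 2 * t) M)) t.
Proof.
  intros Ht. unfold zeta_partial.
  apply (continuous_ext (fun t =>
     minus (sum_n_m (fun n => Im (Rcpow (INR n) (Copp (1, 2 * t)))) 1 M)
     (Im (Cdiv (Rcpow (INR M) (Cminus (RtoC 1) (1, 2 * t)))
            (Cminus (RtoC 1) (1, 2 * t)))))).
  - intros x. rewrite <- Im_sum. reflexivity.
  - apply (continuous_minus (fun t =>
      sum_n_m (fun n => Im (Rcpow (INR n) (Copp (1, 2 * t)))) 1 M)).
    + apply continuous_sum. intros k _. apply continuous_of_derive.
      unfold Rcpow, Rpower; simpl. auto_derive. easy.
    + apply continuous_of_derive. unfold Rcpow, Rpower, Cdiv, Cinv; simpl.
      auto_derive. repeat split; nra.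
Qed.

(** The interval ]0, 2t[ is the ball around t on which the rate K/n is uniform. *)
Lemma continuous_uniform_limit (f : R -> R) (u : nat -> R -> R) (K : R) (t : R) :
  0 < t ->
  (forall n x, 0 < x -> continuous (u n) x) ->
  (forall n x, (1 <= n)%nat -> 0 < x < 2 * t -> Rabs (f x - u n x) <= K / INR n) ->
  continuous f t.
Proof.
  intros Ht Hu Hf. apply continuity_pt_filterlim.
  assert (HK : 0 <= K).
  { generalize (Rabs_pos (f t - u 1%nat t)) (Hf 1%nat t (le_n _) ltac:(lra)). simpl. lra. }
  apply (CVU_continuity (fun n => u (S n)) f t (mkposreal t Ht)).
  - intros eps Heps.
    destruct (nfloor_ex (K / eps)) as [n0 [_ Hn0]].
    { apply Rdiv_le_0_compat; lra. }
    exists n0. intros n y Hn Hy. unfold Boule in Hy; simpl in Hy.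
    apply Rabs_def2 in Hy.
    eapply Rle_lt_trans; [apply Hf; [lia|lra]|].
    assert (L : INR n0 + 1 <= INR (S n)) by (rewrite <- S_INR; apply le_INR; lia).
    assert (0 < INR (S n)) by (apply lt_0_INR; lia).
    apply Rlt_div_l; [easy|]. apply Rlt_div_l in Hn0; [|easy]. nra.
  - intros n y Hy. unfold Boule in Hy; simpl in Hy. apply Rabs_def2 in Hy.
    apply continuity_pt_filterlim, Hu. lra.
  - unfold Boule; simpl. rewrite Rminus_diag, Rabs_R0. easy.
Qed.

Lemma continuous_w (t : R) : 0 < t -> continuous w t.
Proof.
  intros Ht.
  apply (continuous_ext (fun t => plus (mult (Re (zeta (1, 2 * t))) (Re (zeta (1, 2 * t))))
    (mult (Im (zeta (1, 2 * t))) (Im (zeta (1, 2 * t)))))).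
  { intros x. unfold w. rewrite Cmod2_alt. change plus with Rplus. change mult with Rmult.
    ring_in_R. }
  assert (A : continuous (fun t => Re (zeta (1, 2 * t))) t).
  { apply continuous_uniform_limit with
      (u := fun M t => Re (zeta_partial (1, 2 * t) M)) (K := 2 * (1 + 4 * t)); [easy| |].
    - intros; now apply continuous_Re_zeta_partial.
    - intros n x Hn Hx.
      assert (Hs : (1, 2 * x) <> RtoC 1) by (intros E; injection E; lra).
      destruct (is_lim_Re_zeta (1, 2 * x) (Rle_refl 1) Hs) as [_ L].
      eapply Rle_trans; [apply L; easy|]. simpl Re; simpl Im.
      rewrite Rabs_right by lra. apply Rmult_le_compat_r; [|lra].
      left. apply Rinv_0_lt_compat, lt_0_INR. lia. }
  assert (B : continuous (fun t => Im (zeta (1, 2 * t))) t).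
  { apply continuous_uniform_limit with
      (u := fun M t => Im (zeta_partial (1, 2 * t) M)) (K := 2 * (1 + 4 * t)); [easy| |].
    - intros; now apply continuous_Im_zeta_partial.
    - intros n x Hn Hx.
      assert (Hs : (1, 2 * x) <> RtoC 1) by (intros E; injection E; lra).
      destruct (is_lim_Im_zeta (1, 2 * x) (Rle_refl 1) Hs) as [_ L].
      eapply Rle_trans; [apply L; easy|]. simpl Re; simpl Im.
      rewrite Rabs_right by lra. apply Rmult_le_compat_r; [|lra].
      left. apply Rinv_0_lt_compat, lt_0_INR. lia. }
  apply (continuous_plus (fun t => mult (Re (zeta (1, 2 * t))) (Re (zeta (1, 2 * t))))).
  - apply (continuous_mult (fun t => Re (zeta (1, 2 * t)))); easy.
  - apply (continuous_mult (fun t => Im (zeta (1, 2 * t)))); easy.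
Qed.

(** * The Euler product and the 3-4-1 inequality *)

(** The 3-4-1 inequality for one Euler factor: with x = p^(-sigma) and
    c = cos(y ln p), the three squared moduli are (1-x)^2, X = 1 - 2xc + x^2 and
    1 - 2x cos(2 y ln p) + x^2.  The weighted mean of the last one and X is
    bounded by a quantity m free of c, so the inequality between arithmetic and
    geometric means bounds X^4 times the last factor by m^5; a second use of it
    proves (1-x)^6 m^5 <= 1. *)
Lemma three_four_one_local (x c : R) : 0 <= x <= 1 -> -1 <= c <= 1 ->
  (1 - x) ^ 6 * (1 - 2 * x * c + x ^ 2) ^ 4 * (1 - 2 * x * (2 * c ^ 2 - 1) + x ^ 2) <= 1.
Proof.
  intros Hx Hc.
  set (X := 1 - 2 * x * c + x ^ 2).
  set (m := 1 + 6 / 5 * x + x ^ 2).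
  assert (HX : 0 <= X) by (unfold X; nra).
  (* (4 X + last factor)/5 = m - (4/5) x (1 + c)^2. *)
  assert (HD : 1 - 2 * x * (2 * c ^ 2 - 1) + x ^ 2 <= 5 * m - 4 * X).
  { unfold X, m. assert (0 <= x * (1 + c) ^ 2) by (apply Rmult_le_pos; [lra|apply pow2_ge_0]).
    nra. }
  assert (Hm : 0 <= m) by (unfold m; nra).
  assert (AG1 : X ^ 4 * (5 * m - 4 * X) <= m ^ 5).
  { assert (E : m ^ 5 - X ^ 4 * (5 * m - 4 * X)
      = (m - X) ^ 2 * (m ^ 3 + 2 * m ^ 2 * X + 3 * m * X ^ 2 + 4 * X ^ 3)) by ring.
    assert (0 <= (m - X) ^ 2 * (m ^ 3 + 2 * m ^ 2 * X + 3 * m * X ^ 2 + 4 * X ^ 3)).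
    { apply Rmult_le_pos; [apply pow2_ge_0|].
      assert (0 <= m ^ 3) by (apply pow_le; lra).
      assert (0 <= X ^ 3) by (apply pow_le; lra).
      assert (0 <= m ^ 2 * X) by (apply Rmult_le_pos; [apply pow_le|]; lra).
      assert (0 <= m * X ^ 2) by (apply Rmult_le_pos; [|apply pow_le]; lra).
      lra. }
    lra. }
  (* (1 - x) m <= Y, and 6 - 5 Y = 1 - x (1 - x) >= 1 - x. *)
  set (Y := 1 + / 5 * (x * (1 - x))).
  assert (HY : 0 <= Y) by (unfold Y; nra).
  assert (AG2 : Y ^ 5 * (6 - 5 * Y) <= 1).
  { assert (E : 1 - Y ^ 5 * (6 - 5 * Y)
      = (1 - Y) ^ 2 * (1 + 2 * Y + 3 * Y ^ 2 + 4 * Y ^ 3 + 5 * Y ^ 4)) by ring.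
    assert (0 <= (1 - Y) ^ 2 * (1 + 2 * Y + 3 * Y ^ 2 + 4 * Y ^ 3 + 5 * Y ^ 4)).
    { apply Rmult_le_pos; [apply pow2_ge_0|].
      assert (0 <= Y ^ 2) by (apply pow_le; lra).
      assert (0 <= Y ^ 3) by (apply pow_le; lra).
      assert (0 <= Y ^ 4) by (apply pow_le; lra). lra. }
    lra. }
  assert (S1 : (1 - x) ^ 6 * X ^ 4 * (1 - 2 * x * (2 * c ^ 2 - 1) + x ^ 2)
               <= (1 - x) ^ 6 * m ^ 5).
  { rewrite Rmult_assoc. apply Rmult_le_compat_l; [apply pow_le; lra|].
    eapply Rle_trans; [|exact AG1]. apply Rmult_le_compat_l; [apply pow_le; lra|lra]. }
  assert (S2 : (1 - x) ^ 6 * m ^ 5 = (1 - x) * ((1 - x) * m) ^ 5) by ring.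
  assert (S3 : ((1 - x) * m) ^ 5 <= Y ^ 5).
  { apply pow_incr. split; [apply Rmult_le_pos; lra|]. unfold m, Y.
    assert (0 <= x ^ 3) by (apply pow_le; lra). nra. }
  assert (S4 : (1 - x) * Y ^ 5 <= (6 - 5 * Y) * Y ^ 5).
  { apply Rmult_le_compat_r; [apply pow_le; lra|]. unfold Y. nra. }
  assert (S5 : (1 - x) * ((1 - x) * m) ^ 5 <= (1 - x) * Y ^ 5)
    by (apply Rmult_le_compat_l; lra).
  lra.
Qed.

(** Sieving by all integers d >= 2 instead of the primes alone keeps primality out
    of the recursion: for P >= 1, S P is prime iff [rough P (S P)]. *)
Fixpoint rough (P n : nat) : bool :=
  match P with
  | O => true
  | S P' => andb (rough P' n) (orb (Nat.eqb P' 0) (negb (Nat.eqb (n mod (S P')) 0)))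
  end.

Lemma rough_S (P n : nat) : rough (S P) n =
  andb (rough P n) (orb (Nat.eqb P 0) (negb (Nat.eqb (n mod (S P)) 0))).
Proof. reflexivity. Qed.

Lemma roughP (P n : nat) :
  rough P n = true <-> forall d, (2 <= d <= P)%nat -> ~ Nat.divide d n.
Proof.
  induction P as [|P IH].
  - split; [intros _ d Hd; lia|easy].
  - rewrite rough_S, Bool.andb_true_iff, IH, Bool.orb_true_iff, Bool.negb_true_iff,
      Nat.eqb_eq, Nat.eqb_neq. split.
    + intros [A B] d Hd D. destruct (Nat.eq_dec d (S P)) as [->|N].
      * destruct B as [B|B]; [lia|]. apply B, Nat.Lcm0.mod_divide, D.
      * apply (A d); [lia|easy].
    + intros A. split; [intros d Hd; apply A; lia|].
      destruct (Nat.eq_dec P 0) as [E|E]; [now left|right].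
      intros D. apply (A (S P)); [lia|]. apply Nat.Lcm0.mod_divide, D.
Qed.

Definition sifted_sum (P : nat) (s : C) (M : nat) : C :=
  sum_n_m (fun n => if rough P n then Rcpow (INR n) (Copp s) else RtoC 0) 1 M.

(** The product of 1 - p^(-s) over the primes p <= P. *)
Fixpoint inv_euler_product (P : nat) (s : C) : C :=
  match P with
  | O => RtoC 1
  | S P' => if (Nat.ltb 0 P' && rough P' (S P'))%bool
            then Cmult (Cminus (RtoC 1) (Rcpow (INR (S P')) (Copp s)))
                   (inv_euler_product P' s)
            else inv_euler_product P' s
  end.

Lemma inv_euler_product_S (P : nat) (s : C) : inv_euler_product (S P) s =
  if (Nat.ltb 0 P && rough P (S P))%bool
  then Cmult (Cminus (RtoC 1) (Rcpow (INR (S P)) (Copp s))) (inv_euler_product P s)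
  else inv_euler_product P s.
Proof. reflexivity. Qed.

Lemma sum_multiples {G : AbelianMonoid} (f : nat -> G) (p M : nat) : (1 <= p)%nat ->
  sum_n_m (fun n => if Nat.eqb (n mod p) 0 then f n else zero) 1 M =
  sum_n_m (fun m => f (p * m)%nat) 1 (M / p).
Proof.
  intros Hp. induction M as [|M IH].
  - rewrite Nat.Div0.div_0_l, !sum_n_m_zero by lia. reflexivity.
  - rewrite sum_n_Sm, IH by lia.
    generalize (Nat.div_mod_eq M p) (Nat.mod_upper_bound M p ltac:(lia)). intros A B.
    destruct (Nat.eqb_spec (S M mod p) 0) as [D|D].
    + assert (E : (S M / p = S (M / p))%nat).
      { apply Nat.Lcm0.mod_divide in D. destruct D as [q Hq].
        rewrite Hq, Nat.div_mul by lia. nia. }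
      rewrite E, sum_n_Sm by lia. f_equal. f_equal.
      rewrite <- E. generalize (Nat.div_mod_eq (S M) p). lia.
    + rewrite plus_zero_r. f_equal.
      assert (M mod p + 1 <> p)%nat.
      { intros F. apply D. replace (S M) with ((M / p + 1) * p)%nat by nia.
        apply Nat.Div0.mod_mul. }
      apply (Nat.div_unique (S M) p (M / p) (S (M mod p))); lia.
Qed.

(** The hypothesis says that S P is prime, hence coprime to each d <= P with
    d >= 2, so that Gauss's lemma applies. *)
Lemma rough_prime_mult (P m : nat) : rough P (S P) = true ->
  rough P (S P * m) = rough P m.
Proof.
  intros HP. rewrite roughP in HP. apply Bool.eq_iff_eq_true. rewrite !roughP.
  split; intros H d Hd D; apply (H d Hd).
  - now apply Nat.divide_mul_r.
  - apply (Nat.gauss _ (S P)); [exact D|].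
    destruct (Nat.eq_dec (Nat.gcd d (S P)) 1) as [E|E]; [exact E|exfalso].
    apply (HP (Nat.gcd d (S P))); [|apply Nat.gcd_divide_r].
    assert (Nat.gcd d (S P) <= d)%nat by (apply Nat.divide_pos_le; [lia|apply Nat.gcd_divide_l]).
    assert (Nat.gcd d (S P) <> 0)%nat by (intros F; apply Nat.gcd_eq_0 in F; lia).
    lia.
Qed.

Lemma sum_opp_C (f : nat -> C) (n m : nat) :
  sum_n_m (fun k => Copp (f k)) n m = Copp (sum_n_m f n m).
Proof.
  destruct (Nat.lt_ge_cases m n) as [H|H].
  - rewrite !sum_n_m_zero by easy. change zero with (RtoC 0). ring_in_C.
  - induction H as [|m H IH]; [now rewrite !sum_n_n|].
    rewrite !sum_n_Sm, IH by lia. change plus with Cplus. ring_in_C.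
Qed.

Lemma sum_mult_C (c : C) (f : nat -> C) (n m : nat) :
  sum_n_m (fun k => Cmult c (f k)) n m = Cmult c (sum_n_m f n m).
Proof.
  destruct (Nat.lt_ge_cases m n) as [H|H].
  - rewrite !sum_n_m_zero by easy. change zero with (RtoC 0). ring_in_C.
  - induction H as [|m H IH]; [now rewrite !sum_n_n|].
    rewrite !sum_n_Sm, IH by lia. change plus with Cplus. ring_in_C.
Qed.

(** One step of the sieve of Eratosthenes: removing the multiples n = p m of a
    new prime p subtracts p^(-s) times the previous sum up to M/p.  When S P is
    composite, its multiples have already been removed. *)
Lemma sifted_sum_step (P : nat) (s : C) (M : nat) :
  sifted_sum (S P) s M =
  if (Nat.ltb 0 P && rough P (S P))%bool
  then Cminus (sifted_sum P s M)
         (Cmult (Rcpow (INR (S P)) (Copp s)) (sifted_sum P s (M / S P)))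
  else sifted_sum P s M.
Proof.
  destruct (Nat.ltb_spec 0 P) as [HP|HP]; simpl andb.
  2: { unfold sifted_sum. apply sum_n_m_ext. intros n. rewrite rough_S.
       replace P with 0%nat by lia. simpl orb. now rewrite Bool.andb_true_r. }
  destruct (rough P (S P)) eqn:E.
  - assert (X : Cmult (Rcpow (INR (S P)) (Copp s)) (sifted_sum P s (M / S P)) =
      sum_n_m (fun n => if Nat.eqb (n mod S P) 0 then
         (if rough P n then Rcpow (INR n) (Copp s) else RtoC 0) else zero) 1 M).
    { rewrite sum_multiples by lia. unfold sifted_sum. rewrite <- sum_mult_C.
      apply sum_n_m_ext_loc. intros m Hm. rewrite rough_prime_mult by easy.
      destruct (rough P m).
      - rewrite mult_INR, Rcpow_mult; [reflexivity| |]; apply lt_0_INR; lia.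
      - ring_in_C. }
    rewrite X. unfold Cminus. rewrite <- sum_opp_C.
    unfold sifted_sum. rewrite <- (sum_n_m_plus (G := C_AbelianMonoid)).
    apply sum_n_m_ext. intros n. rewrite rough_S.
    replace (Nat.eqb P 0) with false by (symmetry; apply Nat.eqb_neq; lia).
    rewrite Bool.orb_false_l. change plus with Cplus. change zero with (RtoC 0).
    destruct (rough P n), (Nat.eqb (n mod S P) 0); cbn [andb negb]; ring_in_C.
  - unfold sifted_sum. apply sum_n_m_ext. intros n.
    replace (rough (S P) n) with (rough P n); [reflexivity|].
    apply Bool.eq_iff_eq_true. rewrite !roughP. split; intros H d Hd D.
    + destruct (Nat.eq_dec d (S P)) as [->|N]; [|apply (H d); [lia|easy]].
      apply Bool.not_true_iff_false in E. apply E, roughP.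
      intros d Hd' D'. apply (H d Hd'). eapply Nat.divide_trans; eauto.
    + apply (H d); [lia|easy].
Qed.

(** Convergence of complex sequences in modulus, which avoids splitting products
    into components. *)
Definition Ccv (u : nat -> C) (l : C) : Prop :=
  forall eps, 0 < eps -> exists n0, forall n, (n0 <= n)%nat -> Cmod (Cminus (u n) l) < eps.

Lemma Ccv_minus (u v : nat -> C) (l m : C) : Ccv u l -> Ccv v m ->
  Ccv (fun n => Cminus (u n) (v n)) (Cminus l m).
Proof.
  intros Hu Hv eps He.
  destruct (Hu (eps / 2) ltac:(lra)) as [n1 H1], (Hv (eps / 2) ltac:(lra)) as [n2 H2].
  exists (Nat.max n1 n2). intros n Hn.
  replace (Cminus (Cminus (u n) (v n)) (Cminus l m)) with
    (Cplus (Cminus (u n) l) (Copp (Cminus (v n) m))) by ring.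
  eapply Rle_lt_trans; [apply Cmod_triangle|]. rewrite Cmod_opp.
  specialize (H1 n ltac:(lia)). specialize (H2 n ltac:(lia)). lra.
Qed.

Lemma Ccv_mult_l (c : C) (u : nat -> C) (l : C) : Ccv u l ->
  Ccv (fun n => Cmult c (u n)) (Cmult c l).
Proof.
  intros Hu eps He. generalize (Cmod_ge_0 c). intros Hc.
  destruct (Hu (eps / (Cmod c + 1))) as [n0 H0].
  { apply Rdiv_lt_0_compat; lra. }
  exists n0. intros n Hn. specialize (H0 n Hn).
  replace (Cminus (Cmult c (u n)) (Cmult c l)) with (Cmult c (Cminus (u n) l)) by ring.
  rewrite Cmod_mult. apply Rlt_div_r in H0; [|lra].
  generalize (Cmod_ge_0 (Cminus (u n) l)). nra.
Qed.

Lemma Ccv_div_subseq (u : nat -> C) (l : C) (p : nat) : (1 <= p)%nat -> Ccv u l ->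
  Ccv (fun n => u (n / p)%nat) l.
Proof.
  intros Hp Hu eps He. destruct (Hu eps He) as [n0 H0].
  exists (n0 * p)%nat. intros n Hn. apply H0.
  rewrite <- (Nat.div_mul n0 p) by lia. now apply Nat.Div0.div_le_mono.
Qed.

Lemma Rpower_neg_to_0 (h eps : R) : 0 < h -> 0 < eps ->
  exists n0, forall n, (n0 <= n)%nat -> Rpower (INR n) (- h) < eps.
Proof.
  intros Hh He. destruct (nfloor_ex (Rpower (/ eps) (/ h))) as [n0 [_ H0]].
  { left; apply exp_pos. }
  exists (S n0). intros n Hn. rewrite Rpower_Ropp.
  assert (L : INR n0 + 1 <= INR n) by (rewrite <- S_INR; apply le_INR; lia).
  assert (Q : 0 < Rpower (/ eps) (/ h)) by apply exp_pos.
  rewrite <- (Rinv_inv eps). apply Rinv_0_lt_contravar; [now apply Rinv_0_lt_compat|].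
  replace (/ eps) with (Rpower (Rpower (/ eps) (/ h)) h).
  - apply Rlt_Rpower_l; lra.
  - rewrite Rpower_mult, Rinv_l, Rpower_1 by (try lra; now apply Rinv_0_lt_compat). easy.
Qed.

(** For Re s > 1 the correction M^(1-s)/(1-s) tends to 0. *)
Lemma dirichlet_series_zeta (s : C) : 1 < Re s -> Ccv (sifted_sum 0 s) (zeta s).
Proof.
  intros Hs.
  assert (H1 : s <> RtoC 1) by (intros E; rewrite E in Hs; simpl in Hs; lra).
  set (K := 4 * (Re s + Rabs (Im s))).
  assert (HK : 0 < K) by (unfold K; generalize (Rabs_pos (Im s)); lra).
  assert (D0 : Cminus (RtoC 1) s <> RtoC 0).
  { intros E. apply (f_equal Re) in E. destruct s; simpl in *. lra. }
  assert (D : 0 < Cmod (Cminus (RtoC 1) s)) by (now apply Cmod_gt_0).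
  set (d := Cmod (Cminus (RtoC 1) s)) in *.
  intros eps He.
  destruct (Rpower_neg_to_0 (Re s - 1) (eps / 2 * d)) as [n1 H2]; [lra|nra|].
  destruct (nfloor_ex (K / (eps / 2))) as [n2 [_ H3]].
  { apply Rdiv_le_0_compat; lra. }
  exists (S (Nat.max n1 n2)). intros n Hn.
  generalize (zeta_approx s n (Rlt_le _ _ Hs) H1 ltac:(lia)). fold K. intros A.
  replace (Cminus (sifted_sum 0 s n) (zeta s)) with
    (Cplus (Copp (Cminus (zeta s) (zeta_partial s n)))
       (Cdiv (Rcpow (INR n) (Cminus (RtoC 1) s)) (Cminus (RtoC 1) s))).
  2: { unfold zeta_partial, sifted_sum. simpl rough. cbv iota. ring. }
  eapply Rle_lt_trans; [apply Cmod_triangle|].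
  rewrite Cmod_opp, Cmod_div, Cmod_Rcpow by easy. fold d.
  assert (B : K / INR n < eps / 2).
  { assert (L : INR n2 + 1 <= INR n) by (rewrite <- S_INR; apply le_INR; lia).
    apply Rlt_div_l; [apply lt_0_INR; lia|]. apply Rlt_div_l in H3; nra. }
  assert (Cc : Rpower (INR n) (Re (Cminus (RtoC 1) s)) / d < eps / 2).
  { apply Rlt_div_l; [easy|].
    replace (Re (Cminus (RtoC 1) s)) with (- (Re s - 1)) by (destruct s; simpl; ring).
    apply H2; lia. }
  lra.
Qed.

Lemma sifted_sum_limit (P : nat) (s : C) : 1 < Re s ->
  Ccv (sifted_sum P s) (Cmult (inv_euler_product P s) (zeta s)).
Proof.
  intros Hs. induction P as [|P IH].
  - simpl. rewrite Cmult_1_l. now apply dirichlet_series_zeta.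
  - rewrite inv_euler_product_S.
    assert (E := sifted_sum_step P s).
    destruct (Nat.ltb 0 P && rough P (S P))%bool.
    + replace (Cmult (Cmult (Cminus 1 (Rcpow (INR (S P)) (Copp s)))
         (inv_euler_product P s)) (zeta s)) with
       (Cminus (Cmult (inv_euler_product P s) (zeta s))
         (Cmult (Rcpow (INR (S P)) (Copp s)) (Cmult (inv_euler_product P s) (zeta s))))
       by ring.
      intros eps He.
      destruct (Ccv_minus _ _ _ _ IH (Ccv_mult_l (Rcpow (INR (S P)) (Copp s)) _ _
        (Ccv_div_subseq _ _ (S P) ltac:(lia) IH)) eps He) as [n0 H0].
      exists n0. intros n Hn. rewrite E. now apply H0.
    + intros eps He. destruct (IH eps He) as [n0 H0]. exists n0. intros n Hn.
      rewrite E. now apply H0.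
Qed.

(** A number in [2, P] divides itself, so between 1 and P only the term n = 1
    survives the sieve. *)
Lemma sifted_sum_near_1 (P M : nat) (s : C) : (1 <= P <= M)%nat ->
  Cmod (Cminus (sifted_sum P s M) (RtoC 1)) <=
  sum_n_m (fun n => Rpower (INR n) (- Re s)) (S P) M.
Proof.
  intros HP.
  assert (R1 : sifted_sum P s P = RtoC 1).
  { unfold sifted_sum. rewrite sum_Sn_m by lia.
    rewrite (sum_n_m_ext_loc _ (fun _ => RtoC 0)).
    - replace (sum_n_m (fun _ : nat => RtoC 0) 2 P) with (RtoC 0)
        by (symmetry; apply (sum_n_m_const_zero (G := C_AbelianMonoid))).
      replace (rough P 1) with true.
      + simpl INR. rewrite Rcpow_1. change plus with Cplus. ring_in_C.
      + symmetry. apply roughP. intros d Hd D. apply Nat.divide_1_r in D. lia.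
    - intros k Hk. replace (rough P k) with false; [reflexivity|].
      symmetry. apply Bool.not_true_iff_false. rewrite roughP. intros H.
      apply (H k); [lia|apply Nat.divide_refl]. }
  unfold sifted_sum in *. rewrite (sum_n_m_Chasles _ 1 P M), R1 by lia.
  change plus with Cplus.
  assert (E : forall z : C, Cminus (Cplus (RtoC 1) z) (RtoC 1) = z) by (intros; ring).
  rewrite E.
  eapply Rle_trans; [apply Cmod_sum_le|]. apply sum_le_loc. intros k Hk.
  destruct (rough P k).
  - rewrite Cmod_Rcpow. destruct s; simpl. apply Rle_refl.
  - rewrite Cmod_0. left; apply exp_pos.
Qed.

Lemma dirichlet_tail_small (sigma eps : R) : 1 < sigma -> 0 < eps ->
  exists n0, forall P M, (n0 <= P <= M)%nat ->
    sum_n_m (fun n => Rpower (INR n) (- sigma)) (S P) M < eps.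
Proof.
  intros Hs He.
  destruct (dirichlet_series_zeta (sigma, 0) Hs (eps / 2) ltac:(lra)) as [n0 H0].
  exists (S n0). intros P M HPM.
  assert (E : forall n, Re (sifted_sum 0 (sigma, 0) n) =
     sum_n_m (fun n => Rpower (INR n) (- sigma)) 1 n).
  { intros n. unfold sifted_sum. rewrite Re_sum. apply sum_n_m_ext. intros k.
    unfold Rcpow; simpl. rewrite Ropp_0, Rmult_0_l, cos_0. ring. }
  assert (A : forall n, (n0 <= n)%nat ->
    Rabs (sum_n_m (fun n => Rpower (INR n) (- sigma)) 1 n - Re (zeta (sigma, 0))) < eps / 2).
  { intros n Hn. rewrite <- E. eapply Rle_lt_trans; [|apply (H0 n Hn)].
    apply (re_le_Cmod (Cminus (sifted_sum 0 (sigma, 0) n) (zeta (sigma, 0)))). }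
  generalize (A P ltac:(lia)) (A M ltac:(lia)).
  rewrite (sum_n_m_Chasles _ 1 P M) by lia. change plus with Rplus.
  intros B D. apply Rabs_def2 in B. apply Rabs_def2 in D. lra.
Qed.

(** The sifted sum tends to zeta(s) times the product as M grows, and stays
    within the tail of the Dirichlet series beyond P of its first term 1. *)
Lemma euler_product (s : C) : 1 < Re s ->
  is_lim_seq (fun P => Cmod (inv_euler_product P s) * Cmod (zeta s)) 1.
Proof.
  intros Hs. apply is_lim_seq_spec. intros eps.
  destruct (dirichlet_tail_small (Re s) (eps / 2) Hs) as [n0 H0];
    [generalize (cond_pos eps); lra|].
  exists (S n0). intros P HP. rewrite <- Cmod_mult.
  set (z := Cmult (inv_euler_product P s) (zeta s)).
  destruct (sifted_sum_limit P s Hs (eps / 2)) as [n1 H1];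
    [generalize (cond_pos eps); lra|]. fold z in H1.
  set (M := Nat.max P n1).
  specialize (H1 M ltac:(lia)). specialize (H0 P M ltac:(lia)).
  generalize (sifted_sum_near_1 P M s ltac:(lia)). intros A.
  assert (B : Cmod (Cminus z (RtoC 1)) < eps).
  { replace (Cminus z (RtoC 1)) with
     (Cplus (Copp (Cminus (sifted_sum P s M) z)) (Cminus (sifted_sum P s M) (RtoC 1))) by ring.
    eapply Rle_lt_trans; [apply Cmod_triangle|]. rewrite Cmod_opp. lra. }
  apply Rabs_def1.
  - replace z with (Cplus (Cminus z (RtoC 1)) (RtoC 1)) by ring.
    generalize (Cmod_triangle (Cminus z (RtoC 1)) (RtoC 1)). rewrite Cmod_1. lra.
  - generalize (Cmod_triangle (Copp (Cminus z (RtoC 1))) z).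
    replace (Cplus (Copp (Cminus z (RtoC 1))) z) with (RtoC 1) by ring.
    rewrite Cmod_1, Cmod_opp. lra.
Qed.

Lemma euler_factor_Cmod2 (n : nat) (sigma y : R) :
  Cmod (Cminus (RtoC 1) (Rcpow (INR n) (Copp (sigma, y)))) ^ 2 =
  1 - 2 * Rpower (INR n) (- sigma) * cos (y * ln (INR n)) + Rpower (INR n) (- sigma) ^ 2.
Proof.
  rewrite Cmod2_alt. unfold Rcpow; simpl.
  rewrite Ropp_mult_distr_l_reverse, cos_neg, sin_neg.
  generalize (sin2_cos2 (y * ln (INR n))). unfold Rsqr. intros H.
  set (x := Rpower _ _). nra.
Qed.

Lemma three_four_one_partial (P : nat) (sigma y : R) : 0 <= sigma ->
  Cmod (inv_euler_product P (sigma, 0)) ^ 3 * Cmod (inv_euler_product P (sigma, y)) ^ 4 *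
  Cmod (inv_euler_product P (sigma, 2 * y)) <= 1.
Proof.
  intros Hs. induction P as [|P IH].
  - simpl. rewrite Cmod_1. lra.
  - rewrite !inv_euler_product_S. destruct (Nat.ltb 0 P && rough P (S P))%bool; [|exact IH].
    rewrite !Cmod_mult.
    set (n := S P). set (L := ln (INR n)).
    generalize (euler_factor_Cmod2 n sigma 0) (euler_factor_Cmod2 n sigma y)
      (euler_factor_Cmod2 n sigma (2 * y)). fold L.
    set (f1 := Cmod (Cminus _ (Rcpow _ (Copp (sigma, 0))))).
    set (f2 := Cmod (Cminus _ (Rcpow _ (Copp (sigma, y))))).
    set (f3 := Cmod (Cminus _ (Rcpow _ (Copp (sigma, 2 * y))))).
    set (x := Rpower _ _). intros E1 E2 E3.
    rewrite Rmult_0_l, cos_0 in E1.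
    replace (2 * y * L) with (2 * (y * L)) in E3 by ring. rewrite cos_2a_cos in E3.
    set (c := cos (y * L)) in *.
    assert (F1 : 0 <= f1) by apply Cmod_ge_0.
    assert (F2 : 0 <= f2) by apply Cmod_ge_0.
    assert (F3 : 0 <= f3) by apply Cmod_ge_0.
    assert (Hn : 1 <= INR n) by (apply (le_INR 1); unfold n; lia).
    assert (Hx : 0 <= x <= 1).
    { unfold x. split; [left; apply exp_pos|].
      rewrite <- (Rpower_O (INR n)) by lra. apply Rle_Rpower; lra. }
    assert (F : f1 ^ 3 * f2 ^ 4 * f3 <= 1).
    { assert (0 <= f1 ^ 3 * f2 ^ 4 * f3).
      { apply Rmult_le_pos; [apply Rmult_le_pos; apply pow_le|]; easy. }
      assert ((f1 ^ 3 * f2 ^ 4 * f3) ^ 2 <= 1); [|nra].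
      replace ((f1 ^ 3 * f2 ^ 4 * f3) ^ 2) with ((f1 ^ 2) ^ 3 * (f2 ^ 2) ^ 4 * (f3 ^ 2)) by ring.
      rewrite E1, E2, E3.
      replace ((1 - 2 * x * 1 + x ^ 2) ^ 3) with ((1 - x) ^ 6) by ring.
      replace (2 * c * c - 1) with (2 * c ^ 2 - 1) by ring.
      apply three_four_one_local; [easy|apply COS_bound]. }
    match type of IH with ?a <= _ => set (g := a) in * end.
    assert (0 <= g).
    { unfold g. apply Rmult_le_pos; [apply Rmult_le_pos; apply pow_le|]; apply Cmod_ge_0. }
    match goal with |- ?a <= _ =>
      replace a with ((f1 ^ 3 * f2 ^ 4 * f3) * g) by (unfold g; ring) end.
    nra.
Qed.

(** Pass to the limit in [three_four_one_partial]: by the Euler product, each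
    partial product times the corresponding zeta value tends to 1 in modulus. *)
Lemma three_four_one (sigma y : R) : 1 < sigma ->
  1 <= Cmod (zeta (sigma, 0)) ^ 3 * Cmod (zeta (sigma, y)) ^ 4 * Cmod (zeta (sigma, 2 * y)).
Proof.
  intros Hs.
  generalize (euler_product (sigma, 0) Hs) (euler_product (sigma, y) Hs)
    (euler_product (sigma, 2 * y) Hs).
  set (z1 := Cmod (zeta (sigma, 0))). set (z2 := Cmod (zeta (sigma, y))).
  set (z3 := Cmod (zeta (sigma, 2 * y))).
  set (u1 := fun P => Cmod (inv_euler_product P (sigma, 0)) * z1).
  set (u2 := fun P => Cmod (inv_euler_product P (sigma, y)) * z2).
  set (u3 := fun P => Cmod (inv_euler_product P (sigma, 2 * y)) * z3).
  intros L1 L2 L3.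
  assert (L22 := is_lim_seq_mult' _ _ _ _ L2 L2).
  assert (L := is_lim_seq_mult' _ _ _ _
    (is_lim_seq_mult' _ _ _ _ (is_lim_seq_mult' _ _ _ _ L1 (is_lim_seq_mult' _ _ _ _ L1 L1))
      (is_lim_seq_mult' _ _ _ _ L22 L22)) L3).
  replace (Finite (1 * (1 * 1) * (1 * 1 * (1 * 1)) * 1)) with (Finite 1) in L by (f_equal; ring).
  apply (is_lim_seq_le _ (fun _ => z1 ^ 3 * z2 ^ 4 * z3) 1
    (z1 ^ 3 * z2 ^ 4 * z3)) in L; [exact L| |apply is_lim_seq_const].
  intros P. simpl. unfold u1, u2, u3.
  generalize (three_four_one_partial P sigma y ltac:(lra)).
  assert (0 <= z1 ^ 3 * z2 ^ 4 * z3).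
  { apply Rmult_le_pos; [apply Rmult_le_pos; apply pow_le|]; apply Cmod_ge_0. }
  match goal with |- ?a <= 1 -> ?b <= ?c =>
    replace b with (a * (z1 ^ 3 * z2 ^ 4 * z3)) by ring end.
  intros Hg. simpl in *. nra.
Qed.

(** * Nonvanishing of zeta on the line Re s = 1 *)

(** k ln x = ln(x^k) <= x^k - 1. *)
Lemma one_plus_ln_le_power (k x : R) : 0 < k -> 1 <= x ->
  1 + ln x <= (1 + / k) * Rpower x k.
Proof.
  intros Hk Hx.
  assert (P : 1 <= Rpower x k).
  { rewrite <- (Rpower_O x) by lra. apply Rle_Rpower; lra. }
  assert (Q : k * ln x <= Rpower x k - 1).
  { rewrite <- ln_Rpower. apply ln_le_minus_1. lra. }
  assert (ln x <= / k * Rpower x k).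
  { apply Rmult_le_reg_l with k; [easy|]. rewrite <- Rmult_assoc, Rinv_r; lra. }
  lra.
Qed.

Lemma one_minus_Rpower_neg (x h : R) : 1 <= x -> 0 <= h ->
  0 <= 1 - Rpower x (- h) <= h * ln x.
Proof.
  intros Hx Hh. unfold Rpower.
  generalize (exp_ineq1_le (- h * ln x)) (ln_ge_0 x Hx). intros A B.
  split; [|lra].
  assert (exp (- h * ln x) <= exp 0); [|rewrite exp_0 in *; lra].
  destruct (Req_dec (- h * ln x) 0) as [->|N]; [lra|].
  left. apply exp_increasing. nra.
Qed.

(** n^(-h) differs from 1 by at most h ln n, so moving from 1 + iy to 1 + h + iy
    costs h ln M on each term of a harmonic sum; the correction terms are
    treated in the same way. *)
Lemma zeta_partial_shift (h y : R) (M : nat) : 0 < h -> y <> 0 -> (1 <= M)%nat ->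
  Cmod (Cminus (zeta_partial (1 + h, y) M) (zeta_partial (1, y) M)) <=
  h * (1 + / Rabs y + / y ^ 2) * (1 + ln (INR M)) ^ 2.
Proof.
  intros Hh Hy HM.
  assert (HM1 : 1 <= INR M) by (apply (le_INR 1); easy).
  assert (HL := ln_ge_0 _ HM1). set (L := ln (INR M)) in *.
  assert (Hay : 0 < Rabs y) by (now apply Rabs_pos_lt).
  assert (Hy2 : 0 < y ^ 2) by (apply pow2_gt_0; easy).
  assert (split_pow : forall x, Rcpow x (Copp (1 + h, y)) =
     Cmult (Rcpow x (Copp (1, y))) (RtoC (Rpower x (- h)))).
  { intros x. replace (Copp (1 + h, y)) with (Cplus (Copp (1, y)) (- h, 0)).
    - rewrite Rcpow_plus. f_equal. unfold Rcpow, RtoC; simpl.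
      rewrite Rmult_0_l, cos_0, sin_0. f_equal; ring.
    - unfold Cplus, Copp; simpl. f_equal; ring. }
  assert (S1 : Cmod (Cminus
     (sum_n_m (fun n => Rcpow (INR n) (Copp (1 + h, y))) 1 M)
     (sum_n_m (fun n => Rcpow (INR n) (Copp (1, y))) 1 M)) <= h * L * (1 + L)).
  { unfold Cminus. rewrite <- sum_opp_C.
    change Cplus with (@plus C_AbelianMonoid) at 1.
    rewrite <- (sum_n_m_plus (G := C_AbelianMonoid)).
    eapply Rle_trans; [apply Cmod_sum_le|].
    apply Rle_trans with (sum_n_m (fun n => mult (h * L) (/ INR n)) 1 M).
    - apply sum_le_loc. intros k Hk. change mult with Rmult.
      change plus with Cplus. rewrite split_pow.
      assert (K1 : 1 <= INR k) by (apply (le_INR 1); lia).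
      replace (Cplus (Cmult (Rcpow (INR k) (Copp (1, y))) (RtoC (Rpower (INR k) (- h))))
         (Copp (Rcpow (INR k) (Copp (1, y))))) with
        (Cmult (Rcpow (INR k) (Copp (1, y))) (RtoC (Rpower (INR k) (- h) - 1))).
      2: { rewrite RtoC_minus. ring. }
      rewrite Cmod_mult, Cmod_R, Cmod_Rcpow. simpl.
      rewrite Rpower_Ropp, Rpower_1, Rmult_comm by lra.
      assert (0 < / INR k) by (apply Rinv_0_lt_compat; lra).
      apply Rmult_le_compat_r; [lra|].
      destruct (one_minus_Rpower_neg (INR k) h K1 ltac:(lra)) as [A B].
      rewrite Rabs_minus_sym, Rabs_right by lra.
      assert (ln (INR k) <= L) by (apply ln_le; [lra|apply le_INR; lia]). nra.
    - rewrite sum_n_m_mult_l. change mult with Rmult.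
      apply Rmult_le_compat_l; [nra|]. now apply harmonic_le. }
  assert (C1 : Cminus (RtoC 1) (1, y) = (0, - y)).
  { unfold Cminus, Cplus, Copp, RtoC; simpl. f_equal; ring. }
  assert (C2 : Cminus (RtoC 1) (1 + h, y) = (- h, - y)).
  { unfold Cminus, Cplus, Copp, RtoC; simpl. f_equal; ring. }
  assert (N1 : Cmod (0, - y) = Rabs y).
  { unfold Cmod; simpl. rewrite <- sqrt_Rsqr_abs. f_equal. unfold Rsqr. ring. }
  assert (N2 : Rabs y <= Cmod (- h, - y)).
  { rewrite <- Rabs_Ropp. eapply Rle_trans; [|apply Rmax_Cmod]. apply Rmax_r. }
  assert (Z1 : (0, - y) <> RtoC 0) by (intros E; injection E; lra).
  assert (Z2 : (- h, - y) <> RtoC 0) by (intros E; injection E; lra).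
  assert (S2 : Cmod (Cminus
     (Cdiv (Rcpow (INR M) (- h, - y)) (- h, - y))
     (Cdiv (Rcpow (INR M) (0, - y)) (0, - y))) <= h * L * / Rabs y + h * / y ^ 2).
  { replace (Rcpow (INR M) (- h, - y)) with
     (Cmult (Rcpow (INR M) (0, - y)) (RtoC (Rpower (INR M) (- h)))).
    2: { replace (- h, - y) with (Cplus (0, - y) (- h, 0)).
      - rewrite Rcpow_plus. f_equal. unfold Rcpow, RtoC; simpl.
        rewrite Rmult_0_l, cos_0, sin_0. f_equal; ring.
      - unfold Cplus, Copp; simpl. f_equal; ring. }
    replace (Cminus _ _) with (Cmult (Rcpow (INR M) (0, - y))
      (Cplus (Cdiv (RtoC (Rpower (INR M) (- h) - 1)) (- h, - y))
        (Cdiv (RtoC h) (Cmult (- h, - y) (0, - y))))).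
    2: { rewrite RtoC_minus.
         replace (RtoC h) with (Cminus (0, - y) (- h, - y)).
         - field. easy.
         - unfold Cminus, Cplus, Copp, RtoC; simpl. f_equal; ring. }
    rewrite Cmod_mult, Cmod_Rcpow. simpl Re. rewrite Rpower_O, Rmult_1_l by lra.
    eapply Rle_trans; [apply Cmod_triangle|].
    rewrite !Cmod_div, !Cmod_R, Cmod_mult, N1 by (try easy; now apply Cmult_neq_0).
    destruct (one_minus_Rpower_neg (INR M) h HM1 ltac:(lra)) as [A B]. fold L in B.
    rewrite Rabs_minus_sym, !Rabs_right by lra.
    assert (0 < / Rabs y) by (now apply Rinv_0_lt_compat).
    assert (I2 : 0 < / Cmod (- h, - y)) by (apply Rinv_0_lt_compat; lra).
    assert (I3 : / Cmod (- h, - y) <= / Rabs y) by (now apply Rinv_le_contravar).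
    apply Rplus_le_compat.
    - unfold Rdiv. apply Rmult_le_compat; lra.
    - unfold Rdiv. apply Rmult_le_compat_l; [lra|]. rewrite Rinv_mult.
      rewrite <- pow2_abs. simpl. rewrite Rmult_1_r, Rinv_mult.
      apply Rmult_le_compat_r; lra. }
  unfold zeta_partial. rewrite C1, C2.
  match goal with |- Cmod (Cminus (Cminus ?a ?b) (Cminus ?c ?d)) <= _ =>
    replace (Cminus (Cminus a b) (Cminus c d)) with
      (Cplus (Cminus a c) (Copp (Cminus b d))) by ring end.
  eapply Rle_trans; [apply Cmod_triangle|]. rewrite Cmod_opp.
  eapply Rle_trans; [apply Rplus_le_compat; [exact S1|exact S2]|].
  assert (0 < / Rabs y) by (now apply Rinv_0_lt_compat).
  assert (0 < / y ^ 2) by (now apply Rinv_0_lt_compat).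
  set (p := / Rabs y) in *. set (q := / y ^ 2) in *.
  assert (0 <= p * L * L + p * L + p) by nra.
  assert (0 <= q * L * L + 2 * q * L) by nra.
  replace (h * (1 + p + q) * (1 + L) ^ 2) with
    (h * L * (1 + L) + h * L * p + h * q +
     h * (1 + L + (p * L * L + p * L + p) + (q * L * L + 2 * q * L))) by ring.
  assert (0 <= h * (1 + L + (p * L * L + p * L + p) + (q * L * L + 2 * q * L)))
    by (apply Rmult_le_pos; lra).
  lra.
Qed.

(** The truncation at M = 1.  The maximum covers both the real point, where
    zeta grows like 1/(sigma-1), and y <> 0, where it stays bounded. *)
Lemma zeta_bound_right (sigma y : R) : 1 < sigma <= 2 ->
  Cmod (zeta (sigma, y)) <= 9 + 4 * Rabs y + / Rmax (sigma - 1) (Rabs y).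
Proof.
  intros Hs.
  assert (H1 : (sigma, y) <> RtoC 1) by (intros E; injection E; lra).
  generalize (zeta_approx (sigma, y) 1 ltac:(simpl; lra) H1 (le_n _)).
  simpl INR. rewrite Rdiv_1_r. simpl Re. simpl Im. intros A.
  replace (zeta (sigma, y)) with
    (Cplus (Cminus (zeta (sigma, y)) (zeta_partial (sigma, y) 1))
           (zeta_partial (sigma, y) 1)) by ring.
  eapply Rle_trans; [apply Cmod_triangle|].
  assert (B : Cmod (zeta_partial (sigma, y) 1) <= 1 + / Rmax (sigma - 1) (Rabs y)).
  { unfold zeta_partial. rewrite sum_n_n. simpl INR. rewrite !Rcpow_1.
    unfold Cminus at 1. eapply Rle_trans; [apply Cmod_triangle|].
    rewrite Cmod_opp, Cmod_1.
    assert (E : Cminus (RtoC 1) (sigma, y) = (- (sigma - 1), - y)).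
    { unfold Cminus, Cplus, Copp, RtoC; simpl. f_equal; ring. }
    rewrite E, Cmod_div, Cmod_1.
    - apply Rplus_le_compat_l. unfold Rdiv. rewrite Rmult_1_l.
      apply Rinv_le_contravar.
      + eapply Rlt_le_trans; [|apply Rmax_l]. lra.
      + eapply Rle_trans; [|apply Rmax_Cmod]. simpl. rewrite !Rabs_Ropp.
        rewrite (Rabs_right (sigma - 1)); [apply Rle_refl|lra].
    - intros F. injection F. lra. }
  lra.
Qed.

(** If zeta(1+iy) = 0, take sigma = 1 + 1/M.  Truncating at M, the three factors
    of the 3-4-1 inequality are O(M), O((1 + ln M)^2/M) and O(1), so that
    1 << M^3 ((1 + ln M)^2/M)^4 = (1 + ln M)^8/M for every M, which is absurd. *)
Lemma zeta_nonzero (y : R) : y <> 0 -> zeta (1, y) <> RtoC 0.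
Proof.
  intros Hy Hz.
  assert (Hay : 0 < Rabs y) by (now apply Rabs_pos_lt).
  assert (0 < / Rabs y) by (now apply Rinv_0_lt_compat).
  assert (0 < / y ^ 2) by (apply Rinv_0_lt_compat, pow2_gt_0; easy).
  set (C2 := 1 + / Rabs y + / y ^ 2 + 4 * (2 + Rabs y) + 4 * (1 + Rabs y)).
  set (C3 := 9 + 8 * Rabs y + / Rabs y).
  assert (HC2 : 0 < C2) by (unfold C2; lra).
  assert (HC3 : 0 < C3) by (unfold C3; lra).
  assert (main : forall M, (1 <= M)%nat ->
    INR M <= 1000 * C2 ^ 4 * C3 * (1 + ln (INR M)) ^ 8).
  { intros M HM.
    assert (M1 : 1 <= INR M) by (apply (le_INR 1); easy).
    set (h := / INR M).
    assert (Hh : 0 < h) by (apply Rinv_0_lt_compat; lra).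
    assert (Hh1 : h <= 1) by (unfold h; rewrite <- Rinv_1; apply Rinv_le_contravar; lra).
    assert (HhM : h * INR M = 1) by (unfold h; field; lra).
    assert (HL := ln_ge_0 _ M1). set (L := ln (INR M)) in *.
    assert (Z1 : Cmod (zeta (1 + h, 0)) <= 10 * INR M).
    { eapply Rle_trans; [apply zeta_bound_right; lra|].
      rewrite Rabs_R0, Rmax_left by lra.
      replace (1 + h - 1) with h by ring. unfold h. rewrite Rinv_inv. lra. }
    assert (Z3 : Cmod (zeta (1 + h, 2 * y)) <= C3).
    { eapply Rle_trans; [apply zeta_bound_right; lra|].
      rewrite Rabs_mult, (Rabs_right 2) by lra. unfold C3.
      assert (/ Rmax (1 + h - 1) (2 * Rabs y) <= / Rabs y); [|lra].
      apply Rinv_le_contravar; [easy|].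
      eapply Rle_trans; [|apply Rmax_r]. lra. }
    assert (Z2 : Cmod (zeta (1 + h, y)) <= h * C2 * (1 + L) ^ 2).
    { assert (N1 : (1 + h, y) <> RtoC 1) by (intros E; injection E; lra).
      assert (N2 : (1, y) <> RtoC 1) by (intros E; injection E; lra).
      generalize (zeta_approx (1 + h, y) M ltac:(simpl; lra) N1 HM).
      generalize (zeta_approx (1, y) M ltac:(simpl; lra) N2 HM).
      generalize (zeta_partial_shift h y M Hh Hy HM). fold L. simpl Re. simpl Im.
      rewrite Hz. intros A1 A2 A3.
      replace (zeta (1 + h, y)) with
       (Cplus (Cminus (zeta (1 + h, y)) (zeta_partial (1 + h, y) M))
         (Cplus (Cminus (zeta_partial (1 + h, y) M) (zeta_partial (1, y) M))
           (Copp (Cminus (RtoC 0) (zeta_partial (1, y) M))))) by ring.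
      eapply Rle_trans; [apply Cmod_triangle|].
      eapply Rle_trans; [apply Rplus_le_compat_l, Cmod_triangle|].
      rewrite Cmod_opp.
      assert (B1 : 4 * (1 + Rabs y) / INR M <= h * (4 * (1 + Rabs y)) * (1 + L) ^ 2).
      { unfold Rdiv. fold h. assert (1 <= (1 + L) ^ 2) by nra.
        rewrite (Rmult_comm h). apply Rle_trans with (4 * (1 + Rabs y) * h * 1); [lra|].
        apply Rmult_le_compat_l; [|easy]. apply Rmult_le_pos; lra. }
      assert (B3 : 4 * (1 + h + Rabs y) / INR M <= h * (4 * (2 + Rabs y)) * (1 + L) ^ 2).
      { unfold Rdiv. fold h. assert (1 <= (1 + L) ^ 2) by nra.
        rewrite (Rmult_comm h). apply Rle_trans with (4 * (2 + Rabs y) * h * 1); [nra|].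
        apply Rmult_le_compat_l; [|easy]. apply Rmult_le_pos; lra. }
      unfold C2.
      replace (h * (1 + / Rabs y + / y ^ 2 + 4 * (2 + Rabs y) + 4 * (1 + Rabs y)) * (1 + L) ^ 2)
        with (h * (4 * (2 + Rabs y)) * (1 + L) ^ 2 +
          (h * (1 + / Rabs y + / y ^ 2) * (1 + L) ^ 2 + h * (4 * (1 + Rabs y)) * (1 + L) ^ 2))
        by ring.
      lra. }
    assert (T := three_four_one (1 + h) y ltac:(lra)).
    assert (P1 := Cmod_ge_0 (zeta (1 + h, 0))).
    assert (P2 := Cmod_ge_0 (zeta (1 + h, y))).
    assert (P3 := Cmod_ge_0 (zeta (1 + h, 2 * y))).
    assert (U : Cmod (zeta (1 + h, 0)) ^ 3 * Cmod (zeta (1 + h, y)) ^ 4 *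
      Cmod (zeta (1 + h, 2 * y)) <= (10 * INR M) ^ 3 * (h * C2 * (1 + L) ^ 2) ^ 4 * C3).
    { apply Rmult_le_compat; [|easy| |easy].
      - apply Rmult_le_pos; apply pow_le; easy.
      - apply Rmult_le_compat; try (apply pow_le; easy); apply pow_incr; split; easy. }
    assert (V : INR M * ((10 * INR M) ^ 3 * (h * C2 * (1 + L) ^ 2) ^ 4 * C3) =
      1000 * C2 ^ 4 * C3 * (1 + L) ^ 8).
    { transitivity ((h * INR M) ^ 4 * (1000 * C2 ^ 4 * C3 * (1 + L) ^ 8)); [ring|].
      rewrite HhM. ring. }
    nra. }
  (* With exponent 1/16, (1 + ln M)^8 <= 17^8 sqrt M, hence sqrt M <= B. *)
  set (B := 1000 * C2 ^ 4 * C3 * 17 ^ 8).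
  assert (HB : 0 < B).
  { unfold B. apply Rmult_lt_0_compat; [|apply pow_lt; lra].
    apply Rmult_lt_0_compat; [|easy]. apply Rmult_lt_0_compat; [lra|].
    apply pow_lt; easy. }
  destruct (nfloor_ex (B ^ 2)) as [n [_ Hn]]; [apply pow2_ge_0|].
  assert (N1 : 1 <= INR (S n)) by (apply (le_INR 1); lia).
  specialize (main (S n) ltac:(lia)).
  assert (K := one_plus_ln_le_power (/ 16) (INR (S n)) ltac:(lra) N1).
  assert (HL := ln_ge_0 _ N1).
  replace (1 + / / 16) with 17 in K by field.
  assert (K8 : (1 + ln (INR (S n))) ^ 8 <= 17 ^ 8 * sqrt (INR (S n))).
  { replace (sqrt (INR (S n))) with (Rpower (INR (S n)) (/ 16) ^ 8).
    - rewrite <- Rpow_mult_distr. apply pow_incr. lra.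
    - rewrite <- Rpower_pow by apply exp_pos. rewrite Rpower_mult, <- Rpower_sqrt by lra.
      f_equal. simpl. field. }
  assert (Q : INR (S n) <= B * sqrt (INR (S n))).
  { eapply Rle_trans; [exact main|]. unfold B. rewrite (Rmult_assoc _ (17 ^ 8)).
    apply Rmult_le_compat_l; [|easy].
    apply Rmult_le_pos; [|lra]. apply Rmult_le_pos; [lra|]. apply pow_le; lra. }
  set (q := sqrt (INR (S n))) in *.
  assert (E : INR (S n) = q * q) by (unfold q; rewrite sqrt_sqrt; lra).
  assert (Hq : 0 < q) by (apply sqrt_lt_R0; lra).
  rewrite <- S_INR in Hn.
  assert (q <= B) by nra. nra.
Qed.

Lemma w_pos (t : R) : 0 < t -> 0 < w t.
Proof.
  intros Ht. unfold w. apply pow_lt. apply Cmod_gt_0. apply zeta_nonzero. lra.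
Qed.

(** * Off-diagonal terms in the mean value of tau *)

Lemma sum_switch (u : nat -> nat -> R) (a b c d : nat) :
  sum_n_m (fun i => sum_n_m (fun j => u i j) c d) a b =
  sum_n_m (fun j => sum_n_m (fun i => u i j) a b) c d.
Proof.
  destruct (Nat.lt_ge_cases b a) as [L|L].
  - rewrite sum_n_m_zero by easy.
    rewrite (sum_n_m_ext _ (fun _ => zero)).
    + now rewrite sum_n_m_const_zero.
    + intros j. now rewrite sum_n_m_zero.
  - induction L as [|b L IH].
    + rewrite sum_n_n. apply sum_n_m_ext. intros j. now rewrite sum_n_n.
    + rewrite sum_n_Sm, IH by lia. rewrite <- sum_n_m_plus.
      apply sum_n_m_ext. intros j. rewrite sum_n_Sm by lia. reflexivity.
Qed.

Lemma sum_switch4 (u : nat -> nat -> nat -> nat -> R) (p q : nat) :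
  sum_n_m (fun a => sum_n_m (fun b => sum_n_m (fun r => sum_n_m (fun s =>
    u a b r s) 1 q) 1 q) 1 p) 1 p =
  sum_n_m (fun r => sum_n_m (fun s => sum_n_m (fun a => sum_n_m (fun b =>
    u a b r s) 1 p) 1 p) 1 q) 1 q.
Proof.
  transitivity (sum_n_m (fun a => sum_n_m (fun r => sum_n_m (fun s =>
     sum_n_m (fun b => u a b r s) 1 p) 1 q) 1 q) 1 p).
  - apply sum_n_m_ext. intros a.
    rewrite (sum_switch (fun b r => sum_n_m (fun s => u a b r s) 1 q)).
    apply sum_n_m_ext. intros r. apply (sum_switch (fun b s => u a b r s)).
  - rewrite (sum_switch (fun a r => sum_n_m (fun s => sum_n_m (fun b => u a b r s) 1 p) 1 q)).
    apply sum_n_m_ext. intros r.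
    apply (sum_switch (fun a s => sum_n_m (fun b => u a b r s) 1 p)).
Qed.

Lemma sum_ge_0 (f : nat -> R) (n m : nat) :
  (forall k, (n <= k <= m)%nat -> 0 <= f k) -> 0 <= sum_n_m f n m.
Proof.
  intros H. eapply Rle_trans; [|apply (sum_le_loc (fun _ => 0) f); exact H].
  rewrite sum_n_m_const. lra.
Qed.

Lemma sum_ge_term (f : nat -> R) (n m k : nat) :
  (forall j, (n <= j <= m)%nat -> 0 <= f j) -> (n <= k <= m)%nat ->
  f k <= sum_n_m f n m.
Proof.
  intros H Hk. rewrite (sum_n_m_Chasles f n k m) by lia.
  assert (A : 0 <= sum_n_m f (S k) m) by (apply sum_ge_0; intros; apply H; lia).
  destruct k as [|k].
  - replace n with 0%nat by lia. rewrite sum_n_n. change plus with Rplus. lra.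
  - rewrite sum_n_Sm by lia. change plus with Rplus.
    assert (0 <= sum_n_m f n k) by (apply sum_ge_0; intros; apply H; lia). lra.
Qed.

Lemma sum_delta (v : nat -> R) (n m k : nat) : (n <= k <= m)%nat ->
  sum_n_m (fun a => if Nat.eqb a k then v a else 0) n m = v k.
Proof.
  intros Hk.
  assert (Z : forall i j, (forall a, (i <= a <= j)%nat -> a <> k) ->
     sum_n_m (fun a => if Nat.eqb a k then v a else 0) i j = 0).
  { intros i j Hij. rewrite (sum_n_m_ext_loc _ (fun _ => 0)).
    - rewrite sum_n_m_const. apply Rmult_0_r.
    - intros a Ha. specialize (Hij a Ha). now apply Nat.eqb_neq in Hij as ->. }
  rewrite (sum_n_m_Chasles _ n k m) by lia.
  rewrite (Z (S k) m) by (intros; lia). change plus with Rplus. rewrite Rplus_0_r.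
  destruct k as [|k].
  - replace n with 0%nat by lia. rewrite sum_n_n. reflexivity.
  - rewrite sum_n_Sm by lia. rewrite Z by (intros; lia). rewrite Nat.eqb_refl.
    apply Rplus_0_l.
Qed.

(** The equation a s = c has at most one solution a. *)
Lemma sum_at_most_one (s c m : nat) (v : R) : (1 <= s)%nat -> 0 <= v ->
  sum_n_m (fun a => if Nat.eqb (a * s) c then v else 0) 1 m <= v.
Proof.
  intros Hs Hv.
  apply Rle_trans with (sum_n_m (fun a => if Nat.eqb a (c / s) then v else 0)
     0 (Nat.max m (c / s))).
  - rewrite (sum_n_m_Chasles _ 0 m (Nat.max m (c / s))) by lia.
    rewrite (sum_Sn_m _ 0 m) by lia. change plus with Rplus.
    assert (A : 0 <= sum_n_m (fun a => if Nat.eqb a (c / s) then v else 0) (S m)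
      (Nat.max m (c / s))).
    { apply sum_ge_0. intros k _. destruct (Nat.eqb k (c / s)); lra. }
    assert (B : sum_n_m (fun a => if Nat.eqb (a * s) c then v else 0) 1 m <=
      sum_n_m (fun a => if Nat.eqb a (c / s) then v else 0) 1 m).
    { apply sum_le_loc. intros k _. destruct (Nat.eqb_spec (k * s) c) as [E|E].
      - rewrite <- E, Nat.div_mul by lia. rewrite Nat.eqb_refl. lra.
      - destruct (Nat.eqb k (c / s)); lra. }
    destruct (Nat.eqb 0 (c / s)); lra.
  - rewrite (sum_delta (fun _ => v)) by lia. lra.
Qed.

Lemma shifted_harmonic_le (r H : nat) : (1 <= H)%nat -> (1 <= r)%nat ->
  sum_n_m (fun s => if Nat.ltb r s then / (INR s - INR r) else 0) 1 H <= 1 + ln (INR H).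
Proof.
  intros HH Hr.
  assert (E : forall M, sum_n_m (fun s => if Nat.ltb r s then / (INR s - INR r) else 0) 1 M =
    sum_n_m (fun j => / INR j) 1 (M - r)).
  { intros M. induction M as [|M IH].
    - rewrite !sum_n_m_zero by lia. reflexivity.
    - rewrite sum_n_Sm, IH by lia. destruct (Nat.ltb_spec r (S M)) as [L|L].
      + replace (S M - r)%nat with (S (M - r)) by lia. rewrite (sum_n_Sm _ 1 (M - r)) by lia.
        rewrite <- minus_INR by lia. now replace (S M - r)%nat with (S (M - r)) by lia.
      + replace (M - r)%nat with 0%nat by lia. replace (S M - r)%nat with 0%nat by lia.
        change plus with Rplus. apply Rplus_0_r. }
  rewrite E. eapply Rle_trans; [|apply harmonic_le; exact HH].
  rewrite (sum_n_m_Chasles _ 1 (H - r) H) by lia. change plus with Rplus.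
  assert (0 <= sum_n_m (fun n => / INR n) (S (H - r)) H); [|lra].
  apply sum_ge_0. intros k Hk. left. apply Rinv_0_lt_compat, lt_0_INR. lia.
Qed.

(** The natural upper bound for 1/|ln(r/s)|, set to 0 on the diagonal. *)
Definition ratio_weight (r s : nat) : R :=
  if Nat.eqb r s then 0 else INR (Nat.max r s) / Rabs (INR r - INR s).

Lemma ratio_weight_ge_0 (r s : nat) : 0 <= ratio_weight r s.
Proof.
  unfold ratio_weight. destruct (Nat.eqb_spec r s) as [E|E]; [lra|].
  apply Rdiv_le_0_compat; [apply pos_INR|]. apply Rabs_pos_lt.
  intros F. apply E, INR_eq. lra.
Qed.

(** Since max(r,s)/(r s) = 1/min(r,s), the double sum is dominated by twice the
    sum of 1/(r (s - r)) over r < s, at most a product of two harmonic sums. *)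
Lemma ratio_weight_sum_le (H : nat) : (1 <= H)%nat ->
  sum_n_m (fun r => sum_n_m (fun s => INR H / INR (r * s) * ratio_weight r s) 1 H) 1 H
  <= 2 * INR H * (1 + ln (INR H)) ^ 2.
Proof.
  intros HH.
  set (t := fun r s : nat => if Nat.ltb r s then / INR r * / (INR s - INR r) else 0).
  assert (T : sum_n_m (fun r => sum_n_m (fun s => t r s) 1 H) 1 H <= (1 + ln (INR H)) ^ 2).
  { assert (HL : 0 <= ln (INR H)) by (apply ln_ge_0, (le_INR 1); lia).
    apply Rle_trans with (sum_n_m (fun r => mult (/ INR r) (1 + ln (INR H))) 1 H).
    - apply sum_le_loc. intros r Hr.
      rewrite (sum_n_m_ext _ (fun s => mult (/ INR r)
        (if Nat.ltb r s then / (INR s - INR r) else 0))).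
      + rewrite sum_n_m_mult_l. change mult with Rmult.
        apply Rmult_le_compat_l.
        * left. apply Rinv_0_lt_compat, lt_0_INR. lia.
        * apply shifted_harmonic_le; lia.
      + intros s. unfold t. change mult with Rmult. destruct (Nat.ltb r s); lra.
    - rewrite sum_n_m_mult_r. change mult with Rmult. simpl. rewrite Rmult_1_r.
      apply Rmult_le_compat_r; [lra|]. now apply harmonic_le. }
  apply Rle_trans with (sum_n_m (fun r => sum_n_m (fun s =>
     mult (INR H) (plus (t r s) (t s r))) 1 H) 1 H).
  - apply sum_le_loc. intros r Hr. apply sum_le_loc. intros s Hs.
    change mult with Rmult. change plus with Rplus.
    assert (R0 : 0 < INR r) by (apply lt_0_INR; lia).
    assert (S0 : 0 < INR s) by (apply lt_0_INR; lia).
    unfold ratio_weight, t, Rdiv. rewrite mult_INR, Rmult_assoc.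
    apply Rmult_le_compat_l; [apply pos_INR|].
    destruct (Nat.eqb_spec r s) as [->|E].
    + rewrite Nat.ltb_irrefl. lra.
    + destruct (Nat.ltb_spec r s) as [L|L].
      * destruct (Nat.ltb_spec s r); [lia|]. rewrite Nat.max_r by lia.
        assert (INR r < INR s) by (now apply lt_INR).
        rewrite Rabs_left by lra. right. field. lra.
      * destruct (Nat.ltb_spec s r); [|lia]. rewrite Nat.max_l by lia.
        assert (INR s < INR r) by (now apply lt_INR).
        rewrite Rabs_right by lra. right. field. lra.
  - rewrite (sum_n_m_ext _ (fun r => mult (INR H) (plus (sum_n_m (fun s => t r s) 1 H)
        (sum_n_m (fun s => t s r) 1 H)))).
    2: { intros r. rewrite sum_n_m_mult_l. f_equal. apply sum_n_m_plus. }
    rewrite sum_n_m_mult_l, sum_n_m_plus.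
    rewrite (sum_switch (fun r s => t s r)). change mult with Rmult. change plus with Rplus.
    assert (H0 : 0 <= INR H) by apply pos_INR.
    replace (2 * INR H * (1 + ln (INR H)) ^ 2) with
      (INR H * ((1 + ln (INR H)) ^ 2 + (1 + ln (INR H)) ^ 2)) by ring.
    apply Rmult_le_compat_l; [exact H0|]. apply Rplus_le_compat; exact T.
Qed.

(** Write a/n = r/s in lowest terms; then n/b = r/s as well.  With g = gcd(a, n)
    one has n = s g.  As r is coprime to s, it divides n because s n = b r, and
    then divides g because n = s g; hence r s | n. *)
Lemma square_factorisation (a b n : nat) : (1 <= n)%nat -> (a * b = n ^ 2)%nat -> a <> b ->
  exists r s, (1 <= r)%nat /\ (1 <= s)%nat /\ r <> s /\ Nat.divide (r * s) n /\
    (a * s = r * n)%nat /\ (b * r = s * n)%nat.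
Proof.
  intros Hn Hab Hne.
  set (g := Nat.gcd a n).
  assert (Hg : g <> 0%nat) by (intros E; apply Nat.gcd_eq_0 in E; lia).
  destruct (Nat.gcd_divide_l a n) as [r Hr], (Nat.gcd_divide_r a n) as [s Hs].
  fold g in Hr, Hs.
  assert (cop : Nat.gcd r s = 1%nat).
  { assert (X := Nat.gcd_div_gcd a n g Hg eq_refl).
    rewrite Hr, Hs, !Nat.div_mul in X by easy. exact X. }
  assert (Hrb : (b * r = s * n)%nat).
  { apply (Nat.mul_cancel_l _ _ g Hg). rewrite Hs at 1. simpl in Hab. nia. }
  assert (Ha : a <> 0%nat) by (intros ->; simpl in Hab; nia).
  exists r, s. split; [nia|]. split; [nia|]. split.
  { intros E. rewrite E, Nat.gcd_diag in cop. apply Hne. rewrite E, cop in Hr, Hrb. lia. }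
  split; [|split; [rewrite Hr, Hs at 1; ring|exact Hrb]].
  assert (D : Nat.divide r g).
  { apply (Nat.gauss r s g); [|exact cop].
    rewrite <- Hs.
    apply (Nat.gauss r s n); [|exact cop]. exists b. lia. }
  destruct D as [k Hk]. exists k. rewrite Hs, Hk. ring.
Qed.

(** ln y - ln x >= (y - x)/y for 0 < x < y. *)
Lemma ln_ratio_bound (r s : nat) : (1 <= r)%nat -> (1 <= s)%nat -> r <> s ->
  0 < Rabs (ln (INR r) - ln (INR s)) /\
  / Rabs (ln (INR r) - ln (INR s)) <= ratio_weight r s.
Proof.
  assert (main : forall x y, 0 < x < y -> 0 < (y - x) / y <= ln y - ln x).
  { intros x y H. split; [apply Rdiv_lt_0_compat; lra|].
    assert (A := ln_le_minus_1 (x / y) ltac:(apply Rdiv_lt_0_compat; lra)).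
    rewrite ln_div in A by lra.
    replace ((y - x) / y) with (- (x / y - 1)) by (field; lra). lra. }
  intros Hr Hs N. unfold ratio_weight.
  apply Nat.eqb_neq in N as N'. rewrite N'.
  assert (R0 : 0 < INR r) by (apply lt_0_INR; lia).
  assert (S0 : 0 < INR s) by (apply lt_0_INR; lia).
  destruct (Nat.lt_ge_cases r s) as [L|L].
  - rewrite Nat.max_r by lia. apply lt_INR in L.
    destruct (main (INR r) (INR s) ltac:(lra)) as [A B].
    rewrite !Rabs_left by lra. split; [lra|].
    replace (INR s / - (INR r - INR s)) with (/ ((INR s - INR r) / INR s)) by (field; lra).
    apply Rinv_le_contravar; lra.
  - rewrite Nat.max_l by lia. assert (L' : (s < r)%nat) by lia. apply lt_INR in L'.
    destruct (main (INR s) (INR r) ltac:(lra)) as [A B].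
    rewrite !Rabs_right by lra. split; [lra|].
    replace (INR r / (INR r - INR s)) with (/ ((INR r - INR s) / INR r)) by (field; lra).
    apply Rinv_le_contravar; lra.
Qed.

(** Bounds the contribution of the pairs a <> b, a b = n^2, to the integral of
    tau_(it)(n^2) over any interval. *)
Definition offdiag (n : nat) : R :=
  sum_n_m (fun a => sum_n_m (fun b =>
    if (Nat.eqb (a * b) (n ^ 2) && negb (Nat.eqb a b))%bool
    then 2 / Rabs (ln (INR a / INR b)) else 0) 1 (n ^ 2)) 1 (n ^ 2).

(** Each pair (a, b) yields the pair (r, s) of [square_factorisation], from which
    it is recovered by a s = r n and b r = s n.  Instead of reindexing, these
    two equations are inserted as indicators and summed over a and b. *)
Lemma offdiag_le (n H : nat) : (1 <= n <= H)%nat ->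
  offdiag n <= sum_n_m (fun r => sum_n_m (fun s =>
    if Nat.eqb (n mod (r * s)) 0 then ratio_weight r s else 0) 1 H) 1 H.
Proof.
  intros Hn. unfold offdiag.
  set (u := fun a b r s => if Nat.eqb (n mod (r * s)) 0 then
     (if Nat.eqb (a * s) (r * n) then
       (if Nat.eqb (b * r) (s * n) then ratio_weight r s else 0) else 0) else 0).
  assert (U0 : forall a b r s, 0 <= u a b r s).
  { intros. unfold u. generalize (ratio_weight_ge_0 r s).
    destruct (Nat.eqb (n mod (r * s)) 0), (Nat.eqb (a * s) (r * n)),
      (Nat.eqb (b * r) (s * n)); lra. }
  apply Rle_trans with (sum_n_m (fun a => sum_n_m (fun b => sum_n_m (fun r =>
    sum_n_m (fun s => u a b r s) 1 H) 1 H) 1 (n ^ 2)) 1 (n ^ 2)).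
  - apply sum_le_loc. intros a Ha. apply sum_le_loc. intros b Hb.
    assert (S0 : forall r, 0 <= sum_n_m (fun s => u a b r s) 1 H).
    { intros r. apply sum_ge_0. intros s _. apply U0. }
    destruct (Nat.eqb_spec (a * b) (n ^ 2)) as [E|E]; [|apply sum_ge_0; intros; apply S0].
    destruct (Nat.eqb_spec a b) as [F|F]; simpl; [apply sum_ge_0; intros; apply S0|].
    destruct (square_factorisation a b n ltac:(lia) E F)
      as [r [s [Hr [Hs [Hrs [D [Ea Eb]]]]]]].
    assert (B : (r * s <= n)%nat) by (apply Nat.divide_pos_le; [lia|exact D]).
    assert (X : 2 / Rabs (ln (INR a / INR b)) <= u a b r s).
    { unfold u. apply Nat.Lcm0.mod_divide in D. rewrite D, Ea, Eb, !Nat.eqb_refl.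
      destruct (ln_ratio_bound r s Hr Hs Hrs) as [P Q].
      assert (r0 : 0 < INR r) by (apply lt_0_INR; lia).
      assert (s0 : 0 < INR s) by (apply lt_0_INR; lia).
      assert (a0 : 0 < INR a) by (apply lt_0_INR; lia).
      assert (b0 : 0 < INR b) by (apply lt_0_INR; lia).
      assert (n0 : 0 < INR n) by (apply lt_0_INR; lia).
      apply (f_equal INR) in Ea. apply (f_equal INR) in Eb. rewrite !mult_INR in Ea, Eb.
      apply (f_equal ln) in Ea. apply (f_equal ln) in Eb. rewrite !ln_mult in Ea, Eb by easy.
      rewrite ln_div by easy.
      replace (ln (INR a) - ln (INR b)) with (2 * (ln (INR r) - ln (INR s))) by lra.
      rewrite Rabs_mult, (Rabs_right 2) by lra.
      replace (2 / (2 * Rabs (ln (INR r) - ln (INR s)))) with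
        (/ Rabs (ln (INR r) - ln (INR s))) by (field; lra). exact Q. }
    eapply Rle_trans; [exact X|].
    eapply Rle_trans; [|apply (sum_ge_term (fun r => sum_n_m (fun s => u a b r s) 1 H) 1 H r)].
    + apply (sum_ge_term (fun s => u a b r s) 1 H s); [intros; apply U0|nia].
    + intros; apply S0.
    + nia.
  - rewrite (sum_switch4 u). apply sum_le_loc. intros r Hr. apply sum_le_loc. intros s Hs.
    unfold u. assert (W := ratio_weight_ge_0 r s).
    destruct (Nat.eqb (n mod (r * s)) 0).
    + apply Rle_trans with (sum_n_m (fun a => if Nat.eqb (a * s) (r * n)
         then ratio_weight r s else 0) 1 (n ^ 2)).
      * apply sum_le_loc. intros a _. destruct (Nat.eqb (a * s) (r * n)).
        -- apply sum_at_most_one; [lia|easy].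
        -- rewrite sum_n_m_const. lra.
      * apply sum_at_most_one; [lia|easy].
    + right. rewrite (sum_n_m_ext _ (fun _ => 0)).
      * rewrite sum_n_m_const. apply Rmult_0_r.
      * intros a. rewrite sum_n_m_const. apply Rmult_0_r.
Qed.

(** At most H/(r s) integers n <= H are multiples of r s. *)
Lemma offdiag_sum_le (H : nat) : (1 <= H)%nat ->
  sum_n_m offdiag 1 H <= 2 * INR H * (1 + ln (INR H)) ^ 2.
Proof.
  intros HH. eapply Rle_trans; [|apply ratio_weight_sum_le; exact HH].
  eapply Rle_trans.
  { apply sum_le_loc. intros n Hn. apply (offdiag_le n H Hn). }
  rewrite (sum_switch (fun n r => sum_n_m (fun s =>
    if Nat.eqb (n mod (r * s)) 0 then ratio_weight r s else 0) 1 H)).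
  apply sum_le_loc. intros r Hr.
  rewrite (sum_switch (fun n s =>
    if Nat.eqb (n mod (r * s)) 0 then ratio_weight r s else 0)).
  apply sum_le_loc. intros s Hs.
  eapply Rle_trans.
  { right. apply (sum_multiples (G := R_AbelianMonoid) (fun _ => ratio_weight r s)). nia. }
  rewrite sum_n_m_const. apply Rmult_le_compat_r; [apply ratio_weight_ge_0|].
  assert (P : 0 < INR (r * s)) by (apply lt_0_INR; nia).
  apply Rle_div_r; [easy|]. rewrite <- mult_INR. apply le_INR.
  replace (S (H / (r * s)) - 1)%nat with (H / (r * s))%nat by lia.
  rewrite Nat.mul_comm. apply Nat.Div0.mul_div_le.
Qed.

Lemma offdiag_ge_0 (n : nat) : 0 <= offdiag n.
Proof.
  apply sum_ge_0. intros a _. apply sum_ge_0. intros b _.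
  destruct (_ && _)%bool; [|lra].
  apply Rmult_le_pos; [lra|].
  destruct (Req_dec (Rabs (ln (INR a / INR b))) 0) as [->|N]; [rewrite Rinv_0; lra|].
  left. apply Rinv_0_lt_compat. generalize (Rabs_pos (ln (INR a / INR b))). lra.
Qed.

Lemma Re_tau (t : R) (m : nat) : Re (tau t m) =
  sum_n_m (fun a => sum_n_m (fun b =>
    if Nat.eqb (a * b) m then cos (t * ln (INR a / INR b)) else 0) 1 m) 1 m.
Proof.
  unfold tau. rewrite Re_sum. apply sum_n_m_ext. intros a.
  rewrite Re_sum. apply sum_n_m_ext. intros b.
  destruct (Nat.eqb (a * b) m); [|reflexivity].
  unfold Rcpow, Rpower; simpl. rewrite Rmult_0_l, exp_0. apply Rmult_1_l.
Qed.

Lemma is_RInt_sum (f : nat -> R -> R) (I : nat -> R) (a b : R) (n m : nat) :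
  (forall k, (n <= k <= m)%nat -> is_RInt (f k) a b (I k)) ->
  is_RInt (fun t => sum_n_m (fun k => f k t) n m) a b (sum_n_m I n m).
Proof.
  intros H. destruct (Nat.lt_ge_cases m n) as [L|L].
  - rewrite sum_n_m_zero by easy.
    apply (is_RInt_ext (fun _ => 0)); [intros; now rewrite sum_n_m_zero|].
    replace (@zero R_AbelianMonoid) with (scal (b - a) 0) by (apply Rmult_0_r).
    apply (is_RInt_const a b 0).
  - induction L as [|m L IH].
    + rewrite sum_n_n. apply (is_RInt_ext (f n)); [intros; now rewrite sum_n_n|].
      apply H. lia.
    + rewrite sum_n_Sm by lia.
      apply (is_RInt_ext (fun t => plus (sum_n_m (fun k => f k t) n m) (f (S m) t))).
      * intros. rewrite sum_n_Sm by lia. reflexivity.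
      * apply (is_RInt_plus (fun t => sum_n_m (fun k => f k t) n m)); [|apply H; lia].
        apply IH. intros; apply H; lia.
Qed.

Lemma is_RInt_cos (theta a b : R) : theta <> 0 ->
  is_RInt (fun t => cos (t * theta)) a b ((sin (b * theta) - sin (a * theta)) / theta).
Proof.
  intros H.
  replace ((sin (b * theta) - sin (a * theta)) / theta) with
    (minus (sin (b * theta) / theta) (sin (a * theta) / theta)).
  - apply (is_RInt_derive (fun t => sin (t * theta) / theta)).
    + intros x _. auto_derive; [easy|]. field. easy.
    + intros x _. apply continuous_of_derive. auto_derive. easy.
  - unfold minus, plus, opp; simpl. field. easy.
Qed.

(** The pair a = b = n integrates to Delta exactly; any other pair gives the
    integral of cos(t theta) with theta = ln(a/b), at most 2/|theta| in
    absolute value. *)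
Lemma tau_square_mean (n : nat) (T Delta : R) : (1 <= n)%nat -> 0 <= Delta ->
  exists I, is_RInt (fun t => Re (tau t (n ^ 2))) T (T + Delta) I /\
    Delta - offdiag n <= I.
Proof.
  intros Hn HD.
  set (J := fun a b : nat => if Nat.eqb (a * b) (n ^ 2) then
     (if Nat.eqb a b then Delta else
       (sin ((T + Delta) * ln (INR a / INR b)) - sin (T * ln (INR a / INR b)))
         / ln (INR a / INR b)) else 0).
  assert (Hln : forall a b, (1 <= a)%nat -> (1 <= b)%nat -> a <> b -> ln (INR a / INR b) <> 0).
  { intros a b Ha Hb N E. destruct (ln_ratio_bound a b Ha Hb N) as [A _].
    rewrite ln_div in E by (apply lt_0_INR; lia). rewrite E, Rabs_R0 in A. lra. }
  exists (sum_n_m (fun a => sum_n_m (fun b => J a b) 1 (n ^ 2)) 1 (n ^ 2)). split.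
  - apply (is_RInt_ext (fun t => sum_n_m (fun a => sum_n_m (fun b =>
      if Nat.eqb (a * b) (n ^ 2) then cos (t * ln (INR a / INR b)) else 0)
        1 (n ^ 2)) 1 (n ^ 2))); [intros; now rewrite Re_tau|].
    apply is_RInt_sum. intros a Ha. apply is_RInt_sum. intros b Hb. unfold J.
    assert (cst : forall v, is_RInt (fun _ => v) T (T + Delta) (Delta * v)).
    { intros v. replace (Delta * v) with (scal (T + Delta - T) v).
      - apply (is_RInt_const T (T + Delta) v).
      - unfold scal; simpl. unfold mult; simpl. ring. }
    destruct (Nat.eqb (a * b) (n ^ 2)).
    + destruct (Nat.eqb_spec a b) as [->|N].
      * apply (is_RInt_ext (fun _ => 1)).
        -- intros. rewrite Rdiv_diag by (apply not_0_INR; lia).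
           rewrite ln_1, Rmult_0_r, cos_0. reflexivity.
        -- rewrite <- (Rmult_1_r Delta) at 2. apply cst.
      * apply is_RInt_cos. apply Hln; lia.
    + generalize (cst 0). now rewrite Rmult_0_r.
  - assert (D : sum_n_m (fun a => sum_n_m (fun b =>
       if Nat.eqb b n then (if Nat.eqb a n then Delta else 0) else 0) 1 (n ^ 2)) 1 (n ^ 2)
       = Delta).
    { assert (Hn2 : (n <= n ^ 2)%nat) by (simpl; nia).
      rewrite (sum_n_m_ext _ (fun a => if Nat.eqb a n then Delta else 0)).
      - apply (sum_delta (fun _ => Delta)). lia.
      - intros a. apply (sum_delta (fun _ => if Nat.eqb a n then Delta else 0)). lia. }
    enough (Delta <= plus (sum_n_m (fun a => sum_n_m (fun b => J a b) 1 (n ^ 2)) 1 (n ^ 2))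
      (offdiag n)) by (change plus with Rplus in *; lra).
    rewrite <- D at 1. unfold offdiag. rewrite <- sum_n_m_plus.
    apply sum_le_loc. intros a Ha. rewrite <- sum_n_m_plus.
    apply sum_le_loc. intros b Hb. unfold J. change plus with Rplus.
    destruct (Nat.eqb_spec (a * b) (n ^ 2)) as [E|E]; cbn [andb].
    + destruct (Nat.eqb_spec a b) as [->|N]; cbn [negb].
      * destruct (Nat.eqb b n); lra.
      * set (th := ln (INR a / INR b)).
        assert (Hth : th <> 0) by (apply Hln; lia).
        assert (P : 0 < Rabs th) by (now apply Rabs_pos_lt).
        generalize (SIN_bound ((T + Delta) * th)) (SIN_bound (T * th)). intros.
        assert (B : Rabs ((sin ((T + Delta) * th) - sin (T * th)) / th) <= 2 / Rabs th).
        { unfold Rdiv. rewrite Rabs_mult, Rabs_inv.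
          apply Rmult_le_compat_r; [left; now apply Rinv_0_lt_compat|].
          apply Rabs_le. lra. }
        apply Rabs_le_between in B.
        destruct (Nat.eqb_spec b n), (Nat.eqb_spec a n); try lra. congruence.
    + destruct (Nat.eqb_spec b n) as [->|]; [destruct (Nat.eqb_spec a n) as [->|]|]; try lra.
      exfalso. apply E. simpl. lia.
Qed.

(** * Reduction to a choice of test vector *)

Lemma Im_tau (t : R) (m : nat) : Im (tau t m) =
  sum_n_m (fun a => sum_n_m (fun b =>
    if Nat.eqb (a * b) m then sin (t * ln (INR a / INR b)) else 0) 1 m) 1 m.
Proof.
  unfold tau. rewrite Im_sum. apply sum_n_m_ext. intros a.
  rewrite Im_sum. apply sum_n_m_ext. intros b.
  destruct (Nat.eqb (a * b) m); [|reflexivity].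
  unfold Rcpow, Rpower; simpl. rewrite Rmult_0_l, exp_0. apply Rmult_1_l.
Qed.

Lemma continuous_Re_tau (m : nat) (t : R) : continuous (fun t => Re (tau t m)) t.
Proof.
  eapply continuous_ext; [intros x; symmetry; apply Re_tau|].
  apply continuous_sum. intros a _. apply continuous_sum. intros b _.
  destruct (Nat.eqb (a * b) m); [|apply continuous_const].
  apply continuous_of_derive. auto_derive. easy.
Qed.

Lemma continuous_Im_tau (m : nat) (t : R) : continuous (fun t => Im (tau t m)) t.
Proof.
  eapply continuous_ext; [intros x; symmetry; apply Im_tau|].
  apply continuous_sum. intros a _. apply continuous_sum. intros b _.
  destruct (Nat.eqb (a * b) m); [|apply continuous_const].
  apply continuous_of_derive. auto_derive. easy.
Qed.

Lemma Re_real_combination (N : R) (c : nat -> R) (z : nat -> C) :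
  Re (sum_dyadic N (fun n => Cmult (RtoC (c n)) (z n))) =
  sum_dyadic N (fun n => c n * Re (z n)).
Proof.
  unfold sum_dyadic. rewrite Re_sum. apply sum_n_m_ext. intros n.
  destruct (z n) as [x y]. simpl. ring_in_R.
Qed.

Lemma Im_real_combination (N : R) (c : nat -> R) (z : nat -> C) :
  Im (sum_dyadic N (fun n => Cmult (RtoC (c n)) (z n))) =
  sum_dyadic N (fun n => c n * Im (z n)).
Proof.
  unfold sum_dyadic. rewrite Im_sum. apply sum_n_m_ext. intros n.
  destruct (z n) as [x y]. simpl. ring_in_R.
Qed.

Lemma continuous_integrand (N : R) (c : nat -> R) (t : R) : 0 < t ->
  continuous (fun t => / w t *
    (Cmod (sum_dyadic N (fun n => Cmult (RtoC (c n)) (tau t (n ^ 2))))) ^ 2) t.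
Proof.
  intros Ht.
  set (X := fun t => sum_dyadic N (fun n => c n * Re (tau t (n ^ 2)))).
  set (Y := fun t => sum_dyadic N (fun n => c n * Im (tau t (n ^ 2)))).
  assert (HX : continuous X t).
  { apply continuous_sum. intros n _.
    apply (continuous_mult (fun _ => c n) (fun t => Re (tau t (n ^ 2))));
      [apply continuous_const|apply continuous_Re_tau]. }
  assert (HY : continuous Y t).
  { apply continuous_sum. intros n _.
    apply (continuous_mult (fun _ => c n) (fun t => Im (tau t (n ^ 2))));
      [apply continuous_const|apply continuous_Im_tau]. }
  apply (continuous_ext (fun t => mult (/ w t) (plus (mult (X t) (X t)) (mult (Y t) (Y t))))).
  - intros x. rewrite Cmod2_alt, Re_real_combination, Im_real_combination.
    change mult with Rmult. change plus with Rplus.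
    fold (X x). fold (Y x). ring_in_R.
  - apply (continuous_mult (fun t => / w t)).
    + apply continuous_comp; [now apply continuous_w|].
      apply continuous_of_derive. auto_derive.
      assert (P := w_pos t Ht). lra.
    + apply (continuous_plus (fun t => mult (X t) (X t))).
      * now apply (continuous_mult X X).
      * now apply (continuous_mult Y Y).
Qed.

(** The minorant g may take negative values, as 1/w >= 1/W is applied to the
    square before g is compared with it.  Continuity of the integrand, hence the
    nonvanishing of zeta, is what makes its integral comparable with that of
    g/W. *)
Lemma M_infty_lower_bound (Delta T N W I : R) (c : nat -> R) (g : R -> R) :
  1 <= T -> 0 <= Delta -> 0 < W ->
  (forall t, T < t < T + Delta -> w t <= W) ->
  sum_dyadic N (fun n => c n ^ 2) = 1 ->
  is_RInt g T (T + Delta) I ->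
  (forall t, T < t < T + Delta ->
     g t <= (sum_dyadic N (fun n => c n * Re (tau t (n ^ 2)))) ^ 2) ->
  Rbar_le (I / W) (M_infty Delta T N).
Proof.
  intros HT HD HW Hw Hc HI Hg.
  apply Rbar_le_trans with (Finite (M_form Delta T N (fun n => RtoC (c n)))).
  - simpl. unfold M_form.
    apply (is_RInt_le (fun t => scal (/ W) (g t)) (fun t => / w t *
      (Cmod (sum_dyadic N (fun n => Cmult (RtoC (c n)) (tau t (n ^ 2))))) ^ 2)
      T (T + Delta)); [lra| | |].
    + replace (I / W) with (scal (/ W) I) by apply Rmult_comm.
      now apply (is_RInt_scal g).
    + apply (RInt_correct (V := R_CompleteNormedModule)).
      apply (ex_RInt_continuous (V := R_CompleteNormedModule)).
      intros t Ht. rewrite Rmin_left in Ht by lra.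
      apply continuous_integrand. lra.
    + intros t Ht. specialize (Hw t Ht). specialize (Hg t Ht).
      assert (P := w_pos t ltac:(lra)).
      change (/ W * g t <= / w t *
        (Cmod (sum_dyadic N (fun n => Cmult (RtoC (c n)) (tau t (n ^ 2))))) ^ 2).
      set (z := sum_dyadic N (fun n => Cmult (RtoC (c n)) (tau t (n ^ 2)))).
      assert (E : Re z = sum_dyadic N (fun n => c n * Re (tau t (n ^ 2)))).
      { apply Re_real_combination. }
      rewrite <- E in Hg.
      assert (B : (Re z) ^ 2 <= Cmod z ^ 2).
      { rewrite Cmod2_alt. generalize (pow2_ge_0 (Im z)). lra. }
      assert (0 < / W) by (now apply Rinv_0_lt_compat).
      assert (/ W <= / w t) by (now apply Rinv_le_contravar).
      generalize (pow2_ge_0 (Re z)). intros.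
      apply Rle_trans with (/ W * Cmod z ^ 2); [nra|].
      apply Rmult_le_compat_r; lra.
  - apply (proj1 (Lub_Rbar_correct _)).
    exists (fun n => RtoC (c n)). split; [|reflexivity].
    rewrite <- Hc. unfold norm2_dyadic, sum_dyadic. apply sum_n_m_ext. intros n.
    rewrite Cmod_R. apply pow2_abs.
Qed.

(** The least power of 2 that is >= N is < 2N; for N = 1 the exponent k = 1 is
    taken instead, as the sine of frequency (2k+1) ln 2 has to oscillate fast
    enough on an interval of length 1. *)
Lemma power_of_2_in_dyadic (N : R) : 1 <= N ->
  exists k, (1 <= k)%nat /\ N <= 2 ^ k <= 2 * N.
Proof.
  intros HN.
  assert (step : forall m, N <= 2 ^ m -> exists k, (1 <= k)%nat /\ N <= 2 ^ k <= 2 * N).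
  { intros m. induction m as [|m IH]; intros Hm.
    - exists 1%nat. simpl in *. split; [lia|lra].
    - destruct (Rle_dec N (2 ^ m)) as [L|L]; [now apply IH|].
      exists (S m). simpl in *. split; [lia|lra]. }
  destruct (nfloor_ex N ltac:(lra)) as [n [_ Hn]].
  apply (step (S n)). apply Rlt_le, (Rlt_le_trans _ _ _ Hn).
  rewrite <- S_INR. change 2 with (INR 2). rewrite <- pow_INR. apply le_INR.
  generalize (Nat.pow_gt_lin_r 2 (S n) ltac:(lia)). lia.
Qed.

Lemma dyadic_mem (N : R) (x : nat) : 1 <= N -> N <= INR x <= 2 * N ->
  (Z.to_nat (Zceil N) <= x <= Z.to_nat (Zfloor (2 * N)))%nat.
Proof.
  intros HN Hx. rewrite INR_IZR_INZ in Hx.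
  assert (A : (Zceil N <= Z.of_nat x)%Z).
  { apply Z.lt_succ_r, lt_IZR. rewrite succ_IZR.
    destruct (Zceil_bound N). lra. }
  assert (B := Zfloor_lub (Z.of_nat x) (2 * N) ltac:(lra)). lia.
Qed.

Lemma dyadic_bounds (N : R) : 1 <= N ->
  let lo := Z.to_nat (Zceil N) in let hi := Z.to_nat (Zfloor (2 * N)) in
  (1 <= lo <= hi)%nat /\ INR hi <= 2 * N /\ N / 2 <= INR (S hi - lo).
Proof.
  intros HN lo hi.
  destruct (power_of_2_in_dyadic N HN) as [k [_ Hk]].
  assert (M : (lo <= 2 ^ k <= hi)%nat).
  { apply dyadic_mem; [easy|]. rewrite pow_INR. exact Hk. }
  assert (L := Zceil_bound N). assert (F := Zfloor_bound (2 * N)).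
  assert (Elo : INR lo = IZR (Zceil N)).
  { unfold lo. rewrite INR_IZR_INZ, Z2Nat.id; [easy|]. apply le_IZR. simpl. lra. }
  assert (Ehi : INR hi = IZR (Zfloor (2 * N))).
  { unfold hi. rewrite INR_IZR_INZ, Z2Nat.id; [easy|].
    apply Zfloor_lub. simpl. lra. }
  assert (Hlo : (1 <= lo)%nat) by (apply INR_le; simpl; lra).
  split; [lia|]. split; [lra|].
  rewrite minus_INR, S_INR by lia.
  assert (1 <= INR hi + 1 - INR lo) by (generalize (le_INR lo hi ltac:(lia)); lra).
  lra.
Qed.

(** * The constant vector, for long intervals *)

(** With c_n = 1/sqrt K and X = sum_n Re tau_(it)(n^2), the sum is X/sqrt K and
    X^2/K >= 2 X - K, a minorant linear in tau.  Its mean is at least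
    K - (2/Delta) sum_n offdiag n, and the assumed length makes the last term at
    most half of N/2 <= K. *)
Lemma M_infty_long_interval (Delta T N W : R) :
  1 <= T -> 1 <= N -> 0 < W ->
  (forall t, T < t < T + Delta -> w t <= W) ->
  32 * (1 + ln (2 * N)) ^ 2 <= Delta ->
  Rbar_le (Delta * N / 4 / W) (M_infty Delta T N).
Proof.
  intros HT HN HW Hw HD.
  destruct (dyadic_bounds N HN) as [Hlh [Hhi HK]].
  set (lo := Z.to_nat (Zceil N)) in *. set (hi := Z.to_nat (Zfloor (2 * N))) in *.
  set (K := INR (S hi - lo)) in *.
  assert (HK0 : 0 < K) by lra.
  assert (HD0 : 0 <= Delta) by (generalize (pow2_ge_0 (1 + ln (2 * N))); lra).
  set (I := fun n => RInt (fun t => Re (tau t (n ^ 2))) T (T + Delta)).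
  assert (HI : forall n, (1 <= n)%nat ->
    is_RInt (fun t => Re (tau t (n ^ 2))) T (T + Delta) (I n) /\ Delta - offdiag n <= I n).
  { intros n Hn. destruct (tau_square_mean n T Delta Hn HD0) as [v [Hv Hle]].
    unfold I. rewrite (is_RInt_unique _ _ _ _ Hv). easy. }
  set (J := minus (scal 2 (sum_n_m I lo hi)) (scal (T + Delta - T) K)).
  apply Rbar_le_trans with (Finite (J / W)).
  - simpl. apply Rmult_le_compat_r; [left; now apply Rinv_0_lt_compat|].
    assert (S1 : sum_n_m (fun _ => Delta) lo hi <= plus (sum_n_m I lo hi) (sum_n_m offdiag lo hi)).
    { rewrite <- sum_n_m_plus. apply sum_le_loc. intros n Hn.
      destruct (HI n ltac:(lia)) as [_ A]. change plus with Rplus. lra. }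
    rewrite sum_n_m_const in S1. fold K in S1. change plus with Rplus in S1.
    assert (S2 : sum_n_m offdiag lo hi <= 4 * N * (1 + ln (2 * N)) ^ 2).
    { apply Rle_trans with (sum_n_m offdiag 1 hi).
      - destruct (Nat.eq_dec lo 1) as [->|Nlo]; [lra|].
        rewrite (sum_n_m_Chasles offdiag 1 (lo - 1) hi) by lia.
        replace (S (lo - 1)) with lo by lia. change plus with Rplus.
        assert (0 <= sum_n_m offdiag 1 (lo - 1)); [|lra].
        apply sum_ge_0. intros; apply offdiag_ge_0.
      - eapply Rle_trans; [apply offdiag_sum_le; lia|].
        assert (Hh1 : 1 <= INR hi) by (apply (le_INR 1); lia).
        assert (L0 := ln_ge_0 _ Hh1).
        assert (L1 : ln (INR hi) <= ln (2 * N)) by (apply ln_le; lra).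
        assert ((1 + ln (INR hi)) ^ 2 <= (1 + ln (2 * N)) ^ 2) by (apply pow_incr; lra).
        apply Rmult_le_compat; try lra. apply pow2_ge_0. }
    change J with (2 * sum_n_m I lo hi + - ((T + Delta - T) * K)).
    set (Q := (1 + ln (2 * N)) ^ 2) in *.
    assert (N / 2 * Delta <= K * Delta) by (apply Rmult_le_compat_r; lra).
    assert (N * (32 * Q) <= N * Delta) by (apply Rmult_le_compat_l; lra).
    lra.
  - apply M_infty_lower_bound with (c := fun _ => / sqrt K)
      (g := fun t => minus (scal 2 (sum_n_m (fun n => Re (tau t (n ^ 2))) lo hi)) K); auto.
    + unfold sum_dyadic. fold lo hi. rewrite sum_n_m_const. fold K.
      rewrite pow_inv. rewrite pow2_sqrt by lra. apply Rinv_r. lra.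
    + apply (is_RInt_minus (fun t => scal 2 (sum_n_m (fun n => Re (tau t (n ^ 2))) lo hi))
        (fun _ => K)).
      * apply (is_RInt_scal (fun t => sum_n_m (fun n => Re (tau t (n ^ 2))) lo hi)).
        apply is_RInt_sum. intros n Hn. apply HI. lia.
      * apply (is_RInt_const T (T + Delta) K).
    + intros t _. unfold sum_dyadic. fold lo hi.
      set (X := sum_n_m (fun n => Re (tau t (n ^ 2))) lo hi).
      assert (E : sum_n_m (fun n => / sqrt K * Re (tau t (n ^ 2))) lo hi = / sqrt K * X)
        by apply (sum_n_m_mult_l (K := R_Ring)).
      rewrite E.
      change (2 * X + - K <= (/ sqrt K * X) ^ 2).
      rewrite Rpow_mult_distr, pow_inv, pow2_sqrt by lra.
      assert (0 <= / K * (X - K) ^ 2).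
      { apply Rmult_le_pos; [left; now apply Rinv_0_lt_compat|apply pow2_ge_0]. }
      replace (/ K * X ^ 2) with (/ K * (X - K) ^ 2 + (2 * X + - K)) by (field; lra). lra.
Qed.

(** * A vector supported on a power of 2, for bounded NT *)

Lemma factors_of_power_of_2 (m a b : nat) : (a * b = 2 ^ m)%nat ->
  exists j, (j <= m)%nat /\ a = (2 ^ j)%nat /\ b = (2 ^ (m - j))%nat.
Proof.
  revert a b. induction m as [|m IH]; intros a b H.
  - exists 0%nat. simpl in *. apply Nat.eq_mul_1 in H. lia.
  - rewrite Nat.pow_succ_r' in H.
    destruct (Nat.Even_or_Odd a) as [[a' Ha]|[a' Ha]].
    + subst a. destruct (IH a' b ltac:(lia)) as [j [Hj [Ea Eb]]].
      exists (S j). rewrite Nat.pow_succ_r'. split; [lia|]. split; [lia|].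
      exact Eb.
    + destruct (Nat.Even_or_Odd b) as [[b' Hb]|[b' Hb]]; [|subst a b; lia].
      subst b. destruct (IH a b' ltac:(lia)) as [j [Hj [Ea Eb]]].
      exists j. split; [lia|]. split; [easy|].
      replace (S m - j)%nat with (S (m - j)) by lia. rewrite Nat.pow_succ_r'. lia.
Qed.

Lemma sum_over_factors_of_power_of_2 (m : nat) (g : nat -> nat -> R) :
  sum_n_m (fun a => sum_n_m (fun b => if Nat.eqb (a * b) (2 ^ m) then g a b else 0)
    1 (2 ^ m)) 1 (2 ^ m) =
  sum_n_m (fun j => g (2 ^ j)%nat (2 ^ (m - j))%nat) 0 m.
Proof.
  transitivity (sum_n_m (fun a => sum_n_m (fun b => sum_n_m (fun j =>
    if Nat.eqb b (2 ^ (m - j)) then (if Nat.eqb a (2 ^ j) then g a b else 0) else 0)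
      0 m) 1 (2 ^ m)) 1 (2 ^ m)).
  - apply sum_n_m_ext. intros a. apply sum_n_m_ext. intros b.
    destruct (Nat.eqb_spec (a * b) (2 ^ m)) as [E|E].
    + destruct (factors_of_power_of_2 m a b E) as [i [Hi [Ea Eb]]].
      symmetry. etransitivity; [|apply (sum_delta (fun _ => g a b) 0 m i); lia].
      apply sum_n_m_ext_loc. intros j Hj. destruct (Nat.eqb_spec j i) as [->|N].
      * now rewrite Ea, Eb, !Nat.eqb_refl.
      * destruct (Nat.eqb_spec a (2 ^ j)) as [F|F]; [|now destruct (Nat.eqb b (2 ^ (m - j)))].
        exfalso. apply N. rewrite Ea in F. apply Nat.pow_inj_r in F; lia.
    + rewrite (sum_n_m_ext_loc _ (fun _ => 0)).
      * rewrite sum_n_m_const. symmetry. apply Rmult_0_r.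
      * intros j Hj. destruct (Nat.eqb_spec b (2 ^ (m - j))) as [Fb|]; [|easy].
        destruct (Nat.eqb_spec a (2 ^ j)) as [Fa|]; [|easy].
        exfalso. apply E. rewrite Fa, Fb, <- Nat.pow_add_r. f_equal. lia.
  - rewrite (sum_n_m_ext _ (fun a => sum_n_m (fun j => sum_n_m (fun b =>
      if Nat.eqb b (2 ^ (m - j)) then (if Nat.eqb a (2 ^ j) then g a b else 0) else 0)
        1 (2 ^ m)) 0 m)).
    2: { intros a. apply (sum_switch (fun b j => if Nat.eqb b (2 ^ (m - j))
          then (if Nat.eqb a (2 ^ j) then g a b else 0) else 0)). }
    rewrite (sum_switch (fun a j => sum_n_m (fun b =>
      if Nat.eqb b (2 ^ (m - j)) then (if Nat.eqb a (2 ^ j) then g a b else 0) else 0)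
        1 (2 ^ m))).
    apply sum_n_m_ext_loc. intros j Hj.
    assert (P : forall i, (i <= m)%nat -> (1 <= 2 ^ i <= 2 ^ m)%nat).
    { intros i Hi. split; [|now apply Nat.pow_le_mono_r].
      generalize (Nat.pow_nonzero 2 i). lia. }
    rewrite (sum_n_m_ext _ (fun a => if Nat.eqb a (2 ^ j) then g a (2 ^ (m - j))%nat else 0)).
    + apply (sum_delta (fun a => g a (2 ^ (m - j))%nat)). apply P. lia.
    + intros a. apply (sum_delta (fun b => if Nat.eqb a (2 ^ j) then g a b else 0)).
      apply P. lia.
Qed.

(** The Dirichlet kernel: the divisors of 2^(2k) make tau the sum of
    cos((2j - 2k) theta) for 0 <= j <= 2k, which telescopes after
    multiplication by sin theta. *)
Lemma Re_tau_power_of_2 (k : nat) (t : R) :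
  sin (t * ln 2) * Re (tau t ((2 ^ k) ^ 2)) = sin ((2 * INR k + 1) * (t * ln 2)).
Proof.
  rewrite Re_tau, <- Nat.pow_mul_r.
  rewrite (sum_over_factors_of_power_of_2 (k * 2)
    (fun a b => cos (t * ln (INR a / INR b)))).
  set (m := (k * 2)%nat). set (th := t * ln 2).
  assert (E : forall i, (i <= m)%nat -> sin th * sum_n_m (fun j =>
     cos (t * ln (INR (2 ^ j) / INR (2 ^ (m - j))))) 0 i =
     / 2 * (sin ((2 * INR i + 1 - INR m) * th) + sin ((INR m + 1) * th))).
  { assert (T : forall j, (j <= m)%nat ->
      sin th * cos (t * ln (INR (2 ^ j) / INR (2 ^ (m - j)))) =
      / 2 * (sin ((2 * INR j + 1 - INR m) * th) - sin ((2 * INR j - 1 - INR m) * th))).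
    { intros j Hj. rewrite !pow_INR. simpl (INR 2). replace (1 + 1) with 2 by ring.
      rewrite ln_div, !ln_pow, minus_INR by (try apply pow_lt; try lra; easy).
      replace (t * (INR j * ln 2 - (INR m - INR j) * ln 2)) with ((2 * INR j - INR m) * th)
        by (unfold th; ring).
      replace ((2 * INR j + 1 - INR m) * th) with ((2 * INR j - INR m) * th + th) by ring.
      replace ((2 * INR j - 1 - INR m) * th) with ((2 * INR j - INR m) * th - th) by ring.
      rewrite sin_plus, sin_minus. field. }
    intros i. induction i as [|i IH]; intros Hi.
    - rewrite sum_n_n, T by lia. simpl (INR 0).
      replace ((2 * 0 - 1 - INR m) * th) with (- ((INR m + 1) * th)) by ring.
      rewrite sin_neg. ring.
    - rewrite sum_n_Sm by lia. change plus with Rplus.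
      rewrite Rmult_plus_distr_l, IH, T by lia.
      replace (2 * INR (S i) - 1 - INR m) with (2 * INR i + 1 - INR m)
        by (rewrite S_INR; ring). ring. }
  rewrite E by lia.
  replace (INR m) with (2 * INR k) by (unfold m; rewrite mult_INR; simpl; ring).
  replace (2 * (2 * INR k) + 1 - 2 * INR k) with (2 * INR k + 1) by ring.
  field.
Qed.

Lemma is_RInt_sin_sqr (al a b : R) : al <> 0 ->
  is_RInt (fun t => sin (al * t) ^ 2) a b
    ((b - a) / 2 - (sin (2 * (al * b)) - sin (2 * (al * a))) / (4 * al)).
Proof.
  intros H.
  replace ((b - a) / 2 - (sin (2 * (al * b)) - sin (2 * (al * a))) / (4 * al)) with
    (minus (b / 2 - sin (2 * (al * b)) / (4 * al)) (a / 2 - sin (2 * (al * a)) / (4 * al))).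
  - apply (is_RInt_derive (fun t => t / 2 - sin (2 * (al * t)) / (4 * al))).
    + intros x _. auto_derive; [easy|]. rewrite cos_2a_sin. field. easy.
    + intros x _. apply continuous_of_derive. auto_derive. easy.
  - unfold minus, plus, opp; simpl. field. easy.
Qed.

(** As |sin theta| <= 1, the kernel identity bounds tau^2 below by
    sin^2((2k+1) theta).  Since (2k+1) ln 2 >= 3/2, the oscillating part of its
    integral is at most 1/3, which leaves Delta/2 - 1/3 >= Delta/6. *)
Lemma M_infty_any_interval (Delta T N W : R) :
  1 <= T -> 1 <= N -> 1 <= Delta -> 0 < W ->
  (forall t, T < t < T + Delta -> w t <= W) ->
  Rbar_le (Delta / 6 / W) (M_infty Delta T N).
Proof.
  intros HT HN HD HW Hw.
  destruct (power_of_2_in_dyadic N HN) as [k [Hk1 Hk]].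
  assert (HM : (Z.to_nat (Zceil N) <= 2 ^ k <= Z.to_nat (Zfloor (2 * N)))%nat).
  { apply dyadic_mem; [easy|]. rewrite pow_INR. exact Hk. }
  set (al := (2 * INR k + 1) * ln 2).
  assert (Hal : 3 / 2 <= al).
  { unfold al. apply (le_INR 1) in Hk1. simpl in Hk1. generalize ln_lt_2. nra. }
  assert (HI := is_RInt_sin_sqr al T (T + Delta) ltac:(lra)).
  match type of HI with is_RInt _ _ _ ?v => set (I := v) in * end.
  apply Rbar_le_trans with (Finite (I / W)).
  - simpl. apply Rmult_le_compat_r; [left; now apply Rinv_0_lt_compat|].
    unfold I.
    generalize (SIN_bound (2 * (al * (T + Delta)))) (SIN_bound (2 * (al * T))). intros.
    assert ((sin (2 * (al * (T + Delta))) - sin (2 * (al * T))) / (4 * al) <= / 3).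
    { apply Rle_div_l; lra. }
    lra.
  - apply M_infty_lower_bound with (c := fun n => if Nat.eqb n (2 ^ k) then 1 else 0)
      (g := fun t => sin (al * t) ^ 2); auto; [lra| |].
    + unfold sum_dyadic. etransitivity; [|apply (sum_delta (fun _ => 1) _ _ _ HM)].
      apply sum_n_m_ext. intros n. destruct (Nat.eqb n (2 ^ k)); ring_in_R.
    + intros t _. unfold sum_dyadic.
      rewrite (sum_n_m_ext _ (fun n => if Nat.eqb n (2 ^ k) then Re (tau t (n ^ 2)) else 0)).
      * rewrite (sum_delta (fun n => Re (tau t (n ^ 2))) _ _ _ HM).
        replace (al * t) with ((2 * INR k + 1) * (t * ln 2)) by (unfold al; ring).
        rewrite <- Re_tau_power_of_2, Rpow_mult_distr.
        generalize (SIN_bound (t * ln 2)) (pow2_ge_0 (Re (tau t ((2 ^ k) ^ 2)))). intros.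
        assert (sin (t * ln 2) ^ 2 <= 1) by nra. nra.
      * intros n. destruct (Nat.eqb n (2 ^ k)); [apply Rmult_1_l|apply Rmult_0_l].
Qed.

(** * Conclusion *)

Lemma w_le_power (eps t T : R) : 0 < eps -> 1 <= T -> T <= t <= 2 * T ->
  w t <= (16 * (1 + / (eps / 2))) ^ 2 * Rpower T eps.
Proof.
  intros He HT Ht. eapply Rle_trans; [apply w_upper_bound; lra|].
  assert (L : ln (1 + t) <= 2 + ln T).
  { apply Rle_trans with (ln (3 * T)); [apply ln_le; lra|].
    rewrite ln_mult by lra. assert (A := ln_le_minus_1 3 ltac:(lra)). lra. }
  assert (L0 := ln_ge_0 (1 + t) ltac:(lra)). assert (L1 := ln_ge_0 T HT).
  assert (P := one_plus_ln_le_power (eps / 2) T ltac:(lra) HT).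
  replace (Rpower T eps) with (Rpower T (eps / 2) ^ 2).
  - rewrite <- Rpow_mult_distr. apply pow_incr. lra.
  - simpl. rewrite Rmult_1_r, <- Rpower_plus. f_equal. field.
Qed.

Theorem theorem1p5 :
  forall delta c eps : R, 0 < delta -> 0 < c -> 0 < eps ->
  exists C0 : R, 0 < C0 /\
  forall T Delta N : R,
    1 <= T -> 1 <= Delta <= T -> 1 <= N ->
    c * Rpower (N * T) delta <= Delta ->
    Rbar_le (Finite (C0 * (Delta * N * Rpower (N * T) (- eps))))
            (M_infty Delta T N).
Proof.
  intros delta c eps Hd Hc He.
  set (C2 := (16 * (1 + / (eps / 2))) ^ 2).
  set (A := 1 + / (delta / 4)).
  set (X0 := Rpower (128 * A ^ 2 / c) (2 / delta)).
  assert (HC2 : 0 < C2).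
  { apply pow_lt. assert (0 < / (eps / 2)) by (apply Rinv_0_lt_compat; lra). lra. }
  assert (HA : 0 < A).
  { unfold A. assert (0 < / (delta / 4)) by (apply Rinv_0_lt_compat; lra). lra. }
  assert (HX0 : 0 < X0) by apply exp_pos.
  exists (/ (C2 * (4 + 6 * X0))). split.
  { apply Rinv_0_lt_compat, Rmult_lt_0_compat; lra. }
  intros T Delta N HT HD HN Hlow.
  assert (HNT : 1 <= N * T) by nra.
  assert (TNT : T <= N * T) by nra.
  assert (NNT : N <= N * T) by nra.
  set (P := Rpower (N * T) eps).
  assert (HP : 0 < P) by apply exp_pos.
  assert (HW : forall t, T < t < T + Delta -> w t <= C2 * P).
  { intros t Ht. eapply Rle_trans; [apply (w_le_power eps t T He HT); lra|].
    apply Rmult_le_compat_l; [lra|]. apply Rle_Rpower_l; lra. }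
  assert (HCP : 0 < C2 * P) by (now apply Rmult_lt_0_compat).
  assert (HDN : 0 < Delta * N) by (apply Rmult_lt_0_compat; lra).
  rewrite Rpower_Ropp. fold P.
  assert (shape : forall v, / (4 + 6 * X0) * (Delta * N) <= v ->
    / (C2 * (4 + 6 * X0)) * (Delta * N * / P) <= v / (C2 * P)).
  { intros v Hv.
    replace (/ (C2 * (4 + 6 * X0)) * (Delta * N * / P)) with
      (/ (4 + 6 * X0) * (Delta * N) * / (C2 * P)) by (field; lra).
    apply Rmult_le_compat_r; [|exact Hv]. left. now apply Rinv_0_lt_compat. }
  (* In the second case c (NT)^delta <= Delta << (1 + ln 2N)^2 << (NT)^(delta/2)
     forces NT <= X0. *)
  destruct (Rle_dec (32 * (1 + ln (2 * N)) ^ 2) Delta) as [Long|Short].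
  - eapply Rbar_le_trans; [|now apply (M_infty_long_interval Delta T N (C2 * P))].
    simpl. apply shape.
    replace (Delta * N / 4) with (/ 4 * (Delta * N)) by field.
    apply Rmult_le_compat_r; [lra|]. apply Rinv_le_contravar; lra.
  - assert (HNX : N <= X0).
    { apply Rle_trans with (N * T); [easy|].
      set (q := Rpower (N * T) (delta / 4)).
      assert (Hq : 0 < q) by apply exp_pos.
      assert (Eq4 : Rpower (N * T) delta = q ^ 2 * q ^ 2).
      { unfold q. simpl. rewrite !Rmult_1_r, <- !Rpower_plus. f_equal. field. }
      assert (L : 1 + ln (2 * N) <= 2 * (A * q)).
      { apply Rle_trans with (2 * (1 + ln (N * T))).
        - rewrite ln_mult by lra. assert (B := ln_le_minus_1 2 ltac:(lra)).
          assert (ln N <= ln (N * T)) by (apply ln_le; lra).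
          assert (L1 := ln_ge_0 N HN). lra.
        - apply Rmult_le_compat_l; [lra|]. unfold A, q.
          apply one_plus_ln_le_power; lra. }
      assert (L0 := ln_ge_0 (2 * N) ltac:(lra)).
      assert (L2 : (1 + ln (2 * N)) ^ 2 <= (2 * (A * q)) ^ 2) by (apply pow_incr; lra).
      assert (Q2 : 0 < q ^ 2) by (now apply pow_lt).
      assert (B : q ^ 2 <= 128 * A ^ 2 / c).
      { apply (Rle_div_r (q ^ 2) (128 * A ^ 2) c Hc).
        apply Rmult_le_reg_r with (q ^ 2); [easy|]. rewrite Eq4 in Hlow.
        replace ((2 * (A * q)) ^ 2) with (4 * (A ^ 2 * q ^ 2)) in L2 by ring. lra. }
      replace (N * T) with (Rpower (q ^ 2) (2 / delta)).
      - apply Rle_Rpower_l; [|lra]. apply Rdiv_le_0_compat; lra.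
      - unfold q. simpl. rewrite Rmult_1_r, <- Rpower_plus, Rpower_mult.
        replace ((delta / 4 + delta / 4) * (2 / delta)) with 1 by (field; lra).
        apply Rpower_1. lra. }
    eapply Rbar_le_trans;
      [|apply (M_infty_any_interval Delta T N (C2 * P)); [| | | |exact HW]; lra].
    simpl. apply shape.
    apply Rmult_le_reg_l with (4 + 6 * X0); [lra|].
    rewrite <- Rmult_assoc, Rinv_r by lra. nra.
Qed.
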